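(* Any infinite-dimensional Banach space $E$ contains a subspace with a basis that is either tight by range or subsequentially minimal.
   Context: All Banach spaces are real and infinite-dimensional, and ''subspace'' means infinite-dimensional closed subspace. $[x_n\mid n\in A]$ denotes the closed linear span; ''basis'' means (normalised) Schauder basis; $X\sqsubseteq Y$ means that $X$ is isomorphic to a closed subspace of $Y$. Blocks: for a normalised basis $(e_n)$, a countable subfield $\mathbf F$ of $\mathbb R$ containing $\mathbb Q$ is fixed such that the norm of every finite $\mathbf F$-linear combination of $(e_n)$ lies in $\mathbf F$. A block is a norm-one finite $\mathbf F$-linear combination of $(e_n)$; its support is the set of indices with non-zero coefficient, and its range is the smallest interval of $\mathbb N$ containing the support. A block sequence is an infinite sequence of blocks with successive supports. A basis $(e_n)$ is tight by range if for every block sequence $(y_n)$ of $(e_n)$ and every infinite $A\subseteq\mathbb N$, $[y_n]_{n\in\mathbb N}\not\sqsubseteq[e_n\mid n\notin\bigcup_{i\in A}\operatorname{range}y_i]$. (Equivalently, any two block subspaces with disjoint ranges are incomparable, i.e. neither embeds into the other, where the range of $[x_n]$ is $\bigcup_n\operatorname{range}x_n$.) A basis $(x_n)$ is subsequentially minimal if every subspace of $[x_n]$ contains an isomorphic copy of (the closed span of) a subsequence of $(x_n)$. *)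

(* Defs.v *)
From HB Require Import structures.
From mathcomp Require Import all_boot all_order all_algebra.
From mathcomp Require Import all_classical all_reals all_analysis.
Set Implicit Arguments.
Unset Strict Implicit.
Unset Printing Implicit Defensive.
Import Order.TTheory GRing.Theory Num.Theory.
Import numFieldNormedType.Exports.
Local Open Scope classical_set_scope.
Local Open Scope ring_scope.

Section Subspaces.
Context {R : realType} {E : completeNormedModType R}.
Implicit Types (A X Y Z : set E).

Definition lin_span A : set E :=
  smallest [set X | submod_closed (mem X)] A.

Definition closed_span A : set E := closure (lin_span A).

Definition infinite_dimensional X : Prop :=
  ~ exists s : seq E, X `<=` lin_span [set` s].

Definition closed_subspace X : Prop := submod_closed (mem X) /\ closed X.

Definition inf_closed_subspace X : Prop :=
  closed_subspace X /\ infinite_dimensional X.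

Definition linear_on X (T : E -> E) : Prop :=
  forall a : R, {in X &, forall u v, T (a *: u + v) = a *: T u + T v}.

(* Linear homeomorphism of X onto Z; T and S matter only on X and on Z. *)
Definition isomorphic X Z : Prop :=
  exists T S : E -> E,
    [/\ linear_on X T,
        (forall x, X x -> Z (T x) /\ S (T x) = x),
        (forall z, Z z -> X (S z) /\ T (S z) = z),
        {within X, continuous T} &
        {within Z, continuous S}].

Definition embeds X Y : Prop :=
  exists Z, [/\ closed_subspace Z, Z `<=` Y & isomorphic X Z].

End Subspaces.

Section Bases.
Context {R : realType} {E : completeNormedModType R}.
Implicit Types (X Y : set E) (e : nat -> E) (a : nat -> R) (F : {pred R}).

Definition schauder_basis X e : Prop :=
  (forall n, X (e n)) /\
  (forall x, X x ->
     exists! a, series (fun n => a n *: e n) n @[n --> \oo] --> x).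

Definition normalised e : Prop := forall n, `|e n| = 1.

Definition supp a : set nat := [set n | a n != 0].

Definition lincomb e a : E := \sum_(n \in supp a) a n *: e n.

Definition finite_lincomb F a : Prop :=
  finite_set (supp a) /\ forall n, a n \in F.

Definition admissible_subfield e F : Prop :=
  [/\ divring_closed F,
      forall q : rat, ratr q \in F,
      countable [set` F] &
      forall a, finite_lincomb F a -> `|lincomb e a| \in F].

(* A block is represented by its coefficients on e. *)
Definition block e F a : Prop := finite_lincomb F a /\ `|lincomb e a| = 1.

Definition nat_interval (I : set nat) : Prop :=
  forall i j k, I i -> I k -> (i <= j <= k)%N -> I j.

Definition block_range a : set nat := smallest [set I | nat_interval I] (supp a).

Definition block_sequence e F (y : nat -> nat -> R) : Prop :=
  (forall n, block e F (y n)) /\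
  (forall n i j, supp (y n) i -> supp (y n.+1) j -> (i < j)%N).

(* The property is required for every admissible choice of the subfield F, so
   that it depends on e alone; [admissible_subfield_exists] below shows that
   there always is such an F. *)
Definition tight_by_range e : Prop :=
  forall F, admissible_subfield e F ->
  forall y, block_sequence e F y ->
  forall A : set nat, infinite_set A ->
    ~ embeds (closed_span (range (fun n => lincomb e (y n))))
             (closed_span (e @` ~` \bigcup_(i in A) block_range (y i))).

Definition subsequentially_minimal e : Prop :=
  forall Y, inf_closed_subspace Y -> Y `<=` closed_span (range e) ->
  exists phi : nat -> nat,
    increasing_seq phi /\ embeds (closed_span (range (e \o phi))) Y.

(* F is the set of values of terms built from rational constants (leaves) with
   subtraction, division and norms of linear combinations of e. *)
Fixpoint term_value e (t : GenTree.tree rat) : R :=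
  match t with
  | GenTree.Leaf q => ratr q
  | GenTree.Node k ts =>
      let vs := map (term_value e) ts in
      if k == 0%N then vs`_0 - vs`_1
      else if k == 1%N then vs`_0 / vs`_1
      else `|\sum_(i < size vs) vs`_i *: e i|
  end.

Lemma admissible_subfield_exists e : exists F, admissible_subfield e F.
Proof.
exists (fun x => `[< exists t, term_value e t = x >]).
have inF x : reflect (exists t, term_value e t = x)
    (x \in (fun x => `[< exists t, term_value e t = x >])) by exact: asboolP.
split.
- split; first by apply/inF; exists (GenTree.Leaf 1); rewrite /= rmorph1.
  + move=> _ _ /inF[s <-] /inF[t <-]; apply/inF.
    by exists (GenTree.Node 0 [:: s; t]).
  + move=> _ _ /inF[s <-] /inF[t <-]; apply/inF.
    by exists (GenTree.Node 1 [:: s; t]).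
- by move=> q; apply/inF; exists (GenTree.Leaf q).
- apply: (@sub_countable _ _ _ (range (term_value e))).
    by apply: subset_card_le => x /inF[t <-]; exists t.
  exact: (card_le_trans (card_image_le _ _) (countableP _)).
- move=> a [afin aF].
  have /choice[t tE] n : exists t, term_value e t = a n by exact/inF.
  have [N supN] : exists N, supp a `<=` `I_N.
    have /finite_seqP[s ->] := afin.
    by exists (\max_(i <- s) i).+1 => i /= si; rewrite ltnS leq_bigmax_seq.
  apply/inF; exists (GenTree.Node 2 [seq t i | i <- iota 0 N]) => /=.
  rewrite !size_map size_iota; congr `|_|.
  have -> : lincomb e a = \sum_(i \in `I_N) a i *: e i.
    apply: fsbig_widen => // i [_ /= /negP]; rewrite negbK => /eqP ->.
    by rewrite scale0r.
  rewrite -fsbig_ord; apply: eq_bigr => i _.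
  by rewrite -map_comp (nth_map 0%N) ?size_iota//= nth_iota//= tE.
Qed.

End Bases.

(* Main.v *)
Require Import Defs.
From HB Require Import structures.
From mathcomp Require Import all_boot all_order all_algebra.
From mathcomp Require Import all_classical all_reals all_analysis.
From mathcomp Require Import lra zify.
Set Implicit Arguments.
Unset Strict Implicit.
Unset Printing Implicit Defensive.
Import Order.TTheory GRing.Theory Num.Theory.
Import numFieldNormedType.Exports.
Local Open Scope classical_set_scope.
Local Open Scope ring_scope.

(* Call "embedding game" the game in which the first player restricts the second
   to block subspaces, while the latter builds vectors y_0, y_1, ... and, inside
   the span of further vectors F_0, F_1, ... chosen in turn with the y_j, vectors
   u_j such that (u_j) remains K-equivalent to (y_j), for a constant K declared
   together with F_0. By a diagonal argument over the countably many positions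
   there is a block sequence z such that, at every position, either the first
   player wins by playing only tails of z, or he cannot win by playing only tails
   of any further block sequence z' of z; the set of positions of the second kind
   is then one where the second player can stay for ever whatever block subspaces
   of z are played.

   If the first player wins with tails of z from the start, take a subsequence of
   z so sparse that it outruns his strategy on every play with vectors taken from
   finite nets. An embedding of [y_n] into the vectors outside infinitely many
   ranges would yield, after a perturbation, such a play lost by the first player;
   so this subsequence is tight by range. It is essential that K is declared only
   after F_0: the strategies against large K are outrun only from some index on,
   and the u_j may involve vectors of smaller index.

   In the other case the answer y_j depends only on the position, hence on finitely
   many vectors, and not on the subspace Y being played. So one block sequence x
   can enumerate, with repetition, answers to all positions, and for every Y it
   contains a subsequence equivalent to some (u_j) in Y. *)

(** * Recursive choice and finite linear combinations *)

(** Dependent choice in which each term may depend on the whole list of earlier ones; all recursive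
    constructions below use it. *)
Lemma history_choice (T : Type) (P : seq T -> T -> Prop) :
  (forall s, exists x, P s x) -> exists f, forall n, P (mkseq f n) (f n).
Proof.
move=> /choice[g gP]; pose st := fix st n :=
  if n is m.+1 then rcons (st m) (g (st m)) else [::].
exists (fun n => g (st n)) => n.
suff -> : mkseq (fun n => g (st n)) n = st n by [].
by elim: n => //= n IHn; rewrite mkseqS IHn.
Qed.

Lemma sum_widen (K : pzRingType) (U : lmodType K) (f : nat -> U) n m (a : nat -> K) :
  (n <= m)%N -> \sum_(i < n) a i *: f i =
  \sum_(i < m) (if (i < n)%N then a i else 0) *: f i.
Proof.
move=> nm; rewrite (big_ord_widen _ (fun i => a i *: f i) nm) big_mkcond/=.
by apply: eq_bigr => i _; case: ifP; rewrite ?scale0r.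
Qed.

(** The coefficients [c] are chosen before [U] and [f], so that one choice serves two sequences at
    once; they also vanish wherever [a] and [b] both do. *)
Lemma sum_lincomb (K : pzRingType) (r : K) n (a : nat -> K) m (b : nat -> K) :
  exists k (c : nat -> K),
  (forall i, a i = 0 -> b i = 0 -> c i = 0) /\
  forall (U : lmodType K) (f : nat -> U), \sum_(i < k) c i *: f i =
    r *: (\sum_(i < n) a i *: f i) + \sum_(i < m) b i *: f i.
Proof.
exists (maxn n m), (fun i => r * (if (i < n)%N then a i else 0) +
                             (if (i < m)%N then b i else 0)); split.
  by move=> i -> ->; rewrite !if_same mulr0 addr0.
move=> U f; rewrite (sum_widen _ _ (leq_maxl n m)) (sum_widen f b (leq_maxr n m)).
rewrite scaler_sumr -big_split/=.
by apply: eq_bigr => i _; rewrite scalerA -scalerDl.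
Qed.

Lemma sum_delta (K : pzRingType) (U : lmodType K) (f : nat -> U) k :
  f k = \sum_(i < k.+1) (i == k :> nat)%:R *: f i.
Proof.
rewrite big_ord_recr/= eqxx scale1r big1 ?add0r// => i _.
by rewrite ltn_eqF// scale0r.
Qed.

Lemma increasing_leq (phi : nat -> nat) : (forall n, (phi n < phi n.+1)%N) ->
  {homo phi : m n / (m <= n)%N}.
Proof.
by move=> phiS; apply: homo_leq => // [n m k|n]; [exact: leq_trans|exact: ltnW].
Qed.

(** * Linear spans *)

Section LinearAlgebra.
Context {R : realType} {E : completeNormedModType R}.
Implicit Types (v f g : nat -> E) (a b c : nat -> R).

(** There are [n] equations in [n.+1] unknowns, so the matrix of coefficients has a nonzero left
    kernel. *)
Lemma homogeneous_solution (n : nat) (c : nat -> nat -> R) :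
  exists b : nat -> R, (exists2 k, (k <= n)%N & b k != 0) /\
    forall i, (i < n)%N -> \sum_(k < n.+1) b k * c k i = 0.
Proof.
pose A := \matrix_(k < n.+1, i < n) c k i.
have : kermx A != 0.
  rewrite kermx_eq0 -row_leq_rank -ltnNge ltnS; exact: rank_leq_col.
move=> /rowV0Pn[u /sub_kermxP uA u0].
have [k uk] : exists k, u 0 k != 0.
  apply/existsP; apply: contraNT u0 => /existsPn h; apply/eqP/rowP => k.
  by rewrite mxE; apply/eqP; move: (h k); rewrite negbK.
exists (fun j => u 0 (inord j)); split.
  by exists k; rewrite ?inord_val// -ltnS.
move=> i ilt; have := congr1 (fun M : 'rV_n => M 0 (Ordinal ilt)) uA.
rewrite !mxE; apply: etrans; apply: eq_bigr => j _.
by rewrite mxE inord_val.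
Qed.

Lemma lin_span_submod (A : set E) : submod_closed (mem (lin_span A)).
Proof.
split; first by rewrite inE => X [[X0 _] _]; move: X0; rewrite inE.
move=> a u v /set_mem uA /set_mem vA; apply/mem_set => X [Xs AX].
have [_ Xl] := Xs; apply/set_mem/Xl; apply/mem_set; [apply: uA|exact: vA].
by split.
Qed.

Lemma sub_lin_span (A : set E) : A `<=` lin_span A.
Proof. exact: sub_gen_smallest. Qed.

Lemma lin_span_min (A X : set E) :
  submod_closed (mem X) -> A `<=` X -> lin_span A `<=` X.
Proof. exact: smallest_sub. Qed.

Lemma submod_comb (X : set E) : submod_closed (mem X) ->
  forall n a f, (forall i, (i < n)%N -> X (f i)) ->
  X (\sum_(i < n) a i *: f i).
Proof.
move=> [X0 Xl]; elim=> [|n IHn] a f Xf.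
  by rewrite big_ord0; exact/set_mem.
rewrite big_ord_recr/= addrC; apply/set_mem/Xl; apply/mem_set.
  exact: Xf.
by apply: IHn => i ilt; apply: Xf; rewrite ltnS ltnW.
Qed.

Lemma lin_span_seqP (s : seq E) x :
  lin_span [set` s] x <-> exists a, x = \sum_(i < size s) a i *: s`_i.
Proof.
split; last first.
  move=> [a ->]; apply: submod_comb; first exact: lin_span_submod.
  by move=> i ilt; apply: sub_lin_span; exact: mem_nth.
apply: (@lin_span_min _ [set x | exists a, x = \sum_(i < size s) a i *: s`_i]).
  split.
    rewrite inE/=; exists (fun=> 0); rewrite big1// => i _.
    by rewrite scale0r.
  move=> r u w /set_mem/= [a ->] /set_mem/= [b ->]; apply/mem_set => /=.
  exists (fun i => r * a i + b i); rewrite scaler_sumr -big_split/=.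
  by apply: eq_bigr => i _; rewrite scalerA -scalerDl.
move=> y /= ys; exists (fun i => (i == index y s)%:R).
have lt : (index y s < size s)%N by rewrite index_mem.
rewrite (bigD1 (Ordinal lt))//= eqxx scale1r nth_index// big1 ?addr0//.
by move=> i ine; rewrite (_ : (i : nat) == _ = false) ?scale0r//; exact/negbTE.
Qed.

Lemma lin_span_imageP f (B : set nat) x : lin_span (f @` B) x <->
  exists n a, (forall i, ~ B i -> a i = 0) /\ x = \sum_(i < n) a i *: f i.
Proof.
split; last first.
  move=> [n [a [aB ->]]]; have [Xs0 Xl] := lin_span_submod (f @` B).
  elim: n => [|n IHn]; first by rewrite big_ord0; exact/set_mem.
  rewrite big_ord_recr/= addrC; have [/aB ->|/contrapT Bn] := pselect (~ B n).
    by rewrite scale0r add0r.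
  by apply/set_mem/Xl; apply/mem_set => //; apply: sub_lin_span; exists n.
apply: (@lin_span_min _ [set x | exists n a, (forall i, ~ B i -> a i = 0) /\
  x = \sum_(i < n) a i *: f i]).
  split; first by rewrite inE; exists 0%N, (fun=> 0); rewrite big_ord0.
  move=> r u w /set_mem/= [n [a [aB ->]]] /set_mem/= [m [b [bB ->]]]; apply/mem_set => /=.
  have [k [c [c0 cE]]] := sum_lincomb r n a m b; rewrite -cE; exists k, c.
  by split=> // i nB; rewrite c0 ?aB ?bB.
move=> _ [k Bk <-] /=; exists k.+1, (fun i => (i == k)%:R); split; last exact: sum_delta.
by move=> i nB; case: eqP => // ik; case: nB; rewrite ik.
Qed.

Lemma lin_span_rangeP f x : lin_span (range f) x <->
  exists n a, x = \sum_(i < n) a i *: f i.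
Proof.
split=> [/lin_span_imageP[n [a [_ ->]]]|[n [a ->]]]; first by exists n, a.
by apply/lin_span_imageP; exists n, a; split=> // i; case.
Qed.

Definition free_sequence f := forall n a,
  \sum_(k < n) a k *: f k = 0 -> forall k, (k < n)%N -> a k = 0.

Lemma free_sequence_exists : infinite_dimensional [set: E] ->
  exists f, free_sequence f.
Proof.
move=> infE.
have [f fP] : exists f : nat -> E, forall n, ~ lin_span [set` mkseq f n] (f n).
  apply: (@history_choice _ (fun s x => ~ lin_span [set` s] x)) => s.
  apply: contrapT => h; apply: infE; exists s => x _.
  by apply: contrapT => sx; apply: h; exists x.
exists f; elim=> [//|n IHn] a; rewrite big_ord_recr/= => s0.
have an : a n = 0.
  apply/eqP/negPn/negP => an0; apply: (fP n); apply/lin_span_seqP.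
  exists (fun i => - (a n)^-1 * a i).
  rewrite size_mkseq; apply: (@scalerI _ _ (a n)) => //.
  move/eqP: s0; rewrite addr_eq0 => /eqP s0; apply/eqP.
  rewrite -eqr_opp -s0 scaler_sumr -sumrN; apply/eqP/eq_bigr => i _.
  by rewrite nth_mkseq// scalerA mulNr mulrN mulrA divff// mul1r scaleNr opprK.
move=> k; rewrite ltnS leq_eqVlt => /orP[/eqP->//|kn].
by move: s0; rewrite an scale0r addr0 => /IHn; exact.
Qed.

Lemma free_infinite_dimensional f (X : set E) :
  free_sequence f -> (forall n, X (f n)) -> infinite_dimensional X.
Proof.
move=> ff Xf [s Xs].
have /choice[A AP] k : exists a, f k = \sum_(i < size s) a i *: s`_i.
  by have /lin_span_seqP := Xs _ (Xf k).
have [b [[k kn bk] bA]] := homogeneous_solution (size s) A.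
suff /ff/(_ k) : \sum_(k < (size s).+1) b k *: f k = 0.
  by rewrite ltnS => /(_ kn) b0; rewrite b0 eqxx in bk.
under eq_bigr do rewrite AP scaler_sumr.
rewrite exchange_big/= big1// => i _.
under eq_bigr do rewrite scalerA.
by rewrite -scaler_suml bA// scale0r.
Qed.

End LinearAlgebra.

(** * Existence of basic sequences *)

Section BasicSequences.
Context {R : realType} {E : completeNormedModType R}.
Implicit Types (v f g : nat -> E) (a b c : nat -> R).

(* One step of the Hahn-Banach theorem: [c i] is the value at [v i] of a
   functional of norm at most 1. *)
Lemma functional_extension v n c :
  (forall a, \sum_(i < n) a i * c i <= `|\sum_(i < n) a i *: v i|) ->
  exists t, forall a s,
    \sum_(i < n) a i * c i + s * t <= `|\sum_(i < n) a i *: v i + s *: v n|.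
Proof.
move=> cP.
pose L a := \sum_(i < n) a i * c i; pose W a := \sum_(i < n) a i *: v i.
have LZ r a : L (fun i => r * a i) = r * L a.
  by rewrite /L mulr_sumr; apply: eq_bigr => i _; rewrite mulrA.
have WZ r a : W (fun i => r * a i) = r *: W a.
  by rewrite /W scaler_sumr; apply: eq_bigr => i _; rewrite scalerA.
have LD a b : L (fun i => a i + b i) = L a + L b.
  by rewrite /L -big_split; apply: eq_bigr => i _; rewrite mulrDl.
have WD a b : W (fun i => a i + b i) = W a + W b.
  by rewrite /W -big_split; apply: eq_bigr => i _; rewrite scalerDl.
(* The triangle inequality puts every lower bound on the value sought below every upper bound, so
   the supremum of the lower bounds is admissible. *)
have key a b : L a - `|W a - v n| <= `|W b + v n| - L b.
  rewrite lerBrDr -addrA [X in _ + X]addrC addrA lerBlDr -LD.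
  apply: (le_trans (cP _)); rewrite -/(W (fun i => a i + b i)) WD.
  by rewrite (_ : W a + W b = (W b + v n) + (W a - v n)) ?ler_normD//
    addrACA subrr addr0 addrC.
pose S : set R := [set L a - `|W a - v n| | a in [set: nat -> R]].
have S0 : S !=set0 by exists (L (fun=> 0) - `|W (fun=> 0) - v n|), (fun=> 0).
have ubS b : ubound S (`|W b + v n| - L b) by move=> _ [a _ <-].
have supS : has_sup S by split=> //; exists (`|W (fun=> 0) + v n| - L (fun=> 0)).
have lo a : L a - `|W a - v n| <= sup S.
  by apply: sup_upper_bound => //; exists a.
have hi b : sup S <= `|W b + v n| - L b by apply: sup_le_ub.
exists (sup S) => a s; rewrite -/(L a) -/(W a).
have [s0|s0|->] := ltgtP s 0; last by rewrite mul0r scale0r !addr0; exact: cP.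
- have := lo (fun i => (- s)^-1 * a i); rewrite LZ WZ => h.
  have s'0 : 0 < - s by rewrite oppr_gt0.
  have : (- s) * ((- s)^-1 * L a - `|(- s)^-1 *: W a - v n|) <= (- s) * sup S.
    by rewrite ler_pM2l.
  rewrite mulrBr mulrA divff ?gt_eqF// mul1r.
  rewrite -[X in X * `|_|]gtr0_norm// -normrZ scalerBr scalerA divff ?gt_eqF//.
  by rewrite scale1r scaleNr opprK; lra.
- have := hi (fun i => s^-1 * a i); rewrite LZ WZ => h.
  have : s * sup S <= s * (`|s^-1 *: W a + v n| - s^-1 * L a).
    by rewrite ler_pM2l.
  rewrite mulrBr mulrA divff ?gt_eqF// mul1r.
  rewrite -[X in X * `|_|]gtr0_norm// -normrZ scalerDr scalerA divff ?gt_eqF//.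
  by rewrite scale1r; lra.
Qed.

(** Iterating the one-step extension from the value [|v 0|] at [v 0] gives a functional of norm at
    most 1 on the span that norms [v 0]. *)
Lemma norming_functional v n : exists c, c 0%N = `|v 0%N| /\
  forall a, \sum_(i < n.+1) a i * c i <= `|\sum_(i < n.+1) a i *: v i|.
Proof.
elim: n => [|n [c [c0 cP]]].
  exists (fun=> `|v 0%N|); split=> // a; rewrite !big_ord1 normrZ.
  by rewrite ler_wpM2r// ler_norm.
have [t tP] := functional_extension cP.
exists (fun i => if i == n.+1 then t else c i); split=> // a.
rewrite big_ord_recr [X in _ <= `|X|]big_ord_recr/= eqxx.
apply: le_trans (tP a (a n.+1)); rewrite lerD2r le_eqVlt; apply/orP; left.
apply/eqP/eq_bigr => i _; rewrite (_ : (i : nat) == n.+1 = false)//.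
by apply/negbTE; rewrite ltn_eqF.
Qed.

Lemma rational_grid (B eps : R) : 0 < eps ->
  exists D : seq rat, forall c : R, `|c| <= B ->
    exists2 q, q \in D & `|c - ratr q| <= eps.
Proof.
move=> eps0.
pose M := (Num.truncn `|B|).+1; pose N := (Num.truncn eps^-1).+1.
have BM : `|B| < M%:R by rewrite truncnS_gt.
have N0 : 0 < N%:R :> R by rewrite ltr0n.
have Neps : N%:R^-1 <= eps.
  by rewrite -[leRHS]invrK lef_pV2 ?posrE ?invr_gt0// ltW// truncnS_gt.
(* These points have mesh [1 / N] and cover [[-M, M]], where [|B| < M] and [1 / N <= eps]. *)
exists [seq i%:R / N%:R - M%:R | i <- iota 0 (2 * M * N).+1] => c cB.
have := ler_norm B; have := ler_norm c; have := ler_norm (- c).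
rewrite normrN => c1 c2 c3.
have c0 : 0 <= (c + M%:R) * N%:R by rewrite mulr_ge0 ?ltW//; lra.
pose k := Num.truncn ((c + M%:R) * N%:R).
have [kl kr] : k%:R <= (c + M%:R) * N%:R /\ (c + M%:R) * N%:R < k.+1%:R.
  by split; [rewrite truncn_le|rewrite truncnS_gt].
exists (k%:R / N%:R - M%:R).
  apply/mapP; exists k => //; rewrite mem_iota leq0n add0n ltnS -(ler_nat R).
  apply: (le_trans kl); rewrite !natrM ler_wpM2r ?ltW//; lra.
rewrite rmorphB fmorph_div/= !ratr_nat.
have -> : c - (k%:R / N%:R - M%:R) = ((c + M%:R) * N%:R - k%:R) / N%:R.
  by rewrite mulrBl mulfK ?gt_eqF// opprB addrA addrAC.
rewrite normrM normfV [X in _ / X]gtr0_norm//.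
apply: le_trans Neps; rewrite -[leRHS]mul1r ler_wpM2r ?invr_ge0 ?ltW//.
rewrite ger0_norm ?subr_ge0//; move: kr; rewrite -natr1; lra.
Qed.

End BasicSequences.

Section Mazur.
Context {R : realType} {E : completeNormedModType R}.
Implicit Types (v f g : nat -> E) (a b c : nat -> R).

(** Rounding each coefficient to within [eps / S], where [S] bounds the sum of the norms of the
    [f i], moves the vector by at most [eps]. *)
Lemma finite_net f n (B eps : R) : 0 < eps ->
  exists L : seq E, forall a, (forall i, (i < n)%N -> `|a i| <= B) ->
    exists2 y, y \in L & `|\sum_(i < n) a i *: f i - y| <= eps.
Proof.
move=> eps0; pose S := 1 + \sum_(i < n) `|f i|.
have S0 : 0 < S by rewrite ltr_pwDl// sumr_ge0.
have S1 : \sum_(i < n) `|f i| <= S by rewrite lerDr.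
have [D DP] := rational_grid B (divr_gt0 eps0 S0).
exists [seq \sum_(i < n) ratr (val (h i)) *: f i |
        h : {ffun 'I_n -> seq_sub D} <- enum {ffun 'I_n -> seq_sub D}] => a aB.
have /choice[q qP] (i : 'I_n) : exists q : seq_sub D, `|a i - ratr (val q)| <= eps / S.
  by have [q qD h] := DP _ (aB i (ltn_ord i)); exists (SeqSub qD).
exists (\sum_(i < n) ratr (val (q i)) *: f i).
  apply/mapP; exists [ffun i => q i]; first by rewrite mem_enum.
  by apply: eq_bigr => i _; rewrite ffunE.
rewrite -sumrB (le_trans (ler_norm_sum _ _ _))//.
have -> : eps = eps / S * S by rewrite divfK ?gt_eqF.
apply: (@le_trans _ _ (eps / S * \sum_(i < n) `|f i|)); last first.
  by rewrite ler_wpM2l// divr_ge0// ltW.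
rewrite mulr_sumr ler_sum// => i _.
by rewrite -scalerBl normrZ ler_wpM2r.
Qed.

(** The term [a k *: f k] is a difference of two consecutive partial sums, each at most twice the
    whole sum in norm. *)
Lemma partial_sums_coef f n :
  (forall a m k, (m <= k <= n)%N ->
    `|\sum_(i < m) a i *: f i| <= 2 * `|\sum_(i < k) a i *: f i|) ->
  forall a k, (k < n)%N -> `|a k| * `|f k| <= 4 * `|\sum_(i < n) a i *: f i|.
Proof.
move=> fb a k kn.
have := fb a k.+1 n; have := fb a k n.
rewrite kn (ltnW kn) leqnn => /(_ isT) + /(_ isT).
rewrite -normrZ big_ord_recr/=; set w := \sum_(i < k) _.
have := ler_normB (w + a k *: f k) w; rewrite addrAC subrr add0r; lra.
Qed.

(* Every point [y] of a finite net of the unit sphere of the span of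
   [f 0, ..., f n.-1] has a norming functional, and a nonzero vector [x] in the
   common kernel of these satisfies [`|y| <= `|y + s *: x|]. *)
Lemma almost_orthogonal f n (B kappa : R) :
  infinite_dimensional [set: E] -> 1 < kappa ->
  (forall a k, (k < n)%N -> `|a k| <= B * `|\sum_(i < n) a i *: f i|) ->
  exists2 x, `|x| = 1 & forall a (s : R),
    `|\sum_(i < n) a i *: f i| <= kappa * `|\sum_(i < n) a i *: f i + s *: x|.
Proof.
move=> infE k1 fB; have k0 : 0 < kappa by lra.
(* Replacing a unit vector by a net point costs [d] twice, and [1 - 2 * d = kappa^-1]. *)
pose d := (1 - kappa^-1) / 2.
have kV : kappa^-1 < 1 by rewrite invf_lt1.
have d0 : 0 < d by rewrite divr_gt0// subr_gt0.
have [L LP] := finite_net f n B d0.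
have [g gfree] := free_sequence_exists infE.
pose v i := fun k => if k is k'.+1 then g k' else L`_i.
have /choice[c cP] i := norming_functional (v i) (size L).+1.
(* One equation per net point, in one unknown more; the shift [k.+1] skips the entry 0 of [v i],
   which is the net point itself. *)
have [b [[k kL bk] bP]] := homogeneous_solution (size L) (fun k i => c i k.+1).
pose x := \sum_(k < (size L).+1) b k *: g k.
have x0 : x != 0.
  by apply: contra_neq bk => /gfree; apply; rewrite ltnS.
have xL i s : (i < size L)%N -> `|L`_i| <= `|L`_i + s *: x|.
  move=> iL; have [c0 ci] := cP i.
  have := ci (fun k => if k is k'.+1 then s * b k' else 1).
  have -> : \sum_(k < (size L).+2) (if (k : nat) is k'.+1 then s * b k' else 1) *
      c i k = `|L`_i|.
    rewrite big_ord_recl/= mul1r c0 -[RHS]addr0; congr (_ + _).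
    transitivity (s * \sum_(k < (size L).+1) b k * c i k.+1).
      by rewrite mulr_sumr; apply: eq_bigr => j _; rewrite -mulrA.
    by rewrite bP// mulr0.
  rewrite (_ : \sum_(k < _) _ *: _ = L`_i + s *: x)//.
  rewrite big_ord_recl/= scale1r; congr (_ + _).
  by rewrite scaler_sumr; apply: eq_bigr => j _; rewrite scalerA.
have unit a s : `|\sum_(i < n) a i *: f i| = 1 ->
    1 <= kappa * `|\sum_(i < n) a i *: f i + s *: x|.
  set w := \sum_(i < n) a i *: f i => w1.
  have [y yL wy] : exists2 y, y \in L & `|w - y| <= d.
    by apply: LP => i ilt; apply: (le_trans (fB _ _ ilt)); rewrite w1 mulr1.
  have := xL _ s (eq_ind_r is_true yL (index_mem y L)); rewrite nth_index// => yx.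
  have d2 : 2 * d = 1 - kappa^-1 by rewrite /d; lra.
  rewrite mulrC -ler_pdivrMr// div1r.
  have h1 : `|w| <= `|w - y| + `|y| by rewrite -[X in `|X| <= _](subrK y) ler_normD.
  have h2 : `|y + s *: x| <= `|w + s *: x| + `|w - y|.
    rewrite -(distrC y w) (le_trans _ (ler_normD _ _))//.
    by rewrite [X in _ <= `|X|]addrC addrA subrK.
  by move: w1; lra.
exists (`|x|^-1 *: x).
  by rewrite normrZ normfV normr_id mulVf// normr_eq0.
move=> a s; rewrite scalerA; set t := s / `|x|.
set w := \sum_(i < n) a i *: f i.
have [->|w0] := eqVneq w 0; first by rewrite normr0 mulr_ge0// ltW.
have n0 : 0 < `|w| by rewrite normr_gt0.
have wE : \sum_(i < n) (`|w|^-1 * a i) *: f i = `|w|^-1 *: w.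
  by rewrite scaler_sumr; apply: eq_bigr => i _; rewrite scalerA.
have := unit (fun i => `|w|^-1 * a i) (`|w|^-1 * t).
rewrite wE -scalerA -scalerDr !normrZ normfV normr_id mulVf ?gt_eqF// => /(_ erefl).
by rewrite mulrCA ler_pdivlMl// mulr1.
Qed.

(* The constant 2 stands for any constant greater than 1. *)
Definition basic_sequence f := (forall n, f n != 0) /\
  forall a m n, (m <= n)%N ->
    `|\sum_(i < m) a i *: f i| <= 2 * `|\sum_(i < n) a i *: f i|.

Lemma basic_coef f : basic_sequence f -> forall a n k, (k < n)%N ->
  `|a k| * `|f k| <= 4 * `|\sum_(i < n) a i *: f i|.
Proof.
by move=> [_ fb] a n k; apply: partial_sums_coef => b i j /andP[ij _]; exact: fb.
Qed.

Lemma basic_free f : basic_sequence f -> free_sequence f.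
Proof.
move=> bf n a s0 k kn; have := basic_coef bf a kn.
rewrite s0 normr0 mulr0 pmulr_lle0 ?normr_gt0; last by case: bf => + _; apply.
by rewrite normr_le0 => /eqP.
Qed.

(** Later blocks vanish below [s j], so a partial sum of the blocks is a partial sum over [f], and
    the constant 2 is inherited. *)
Lemma basic_blocks f (c : nat -> nat -> R) (s : nat -> nat) : basic_sequence f ->
  {homo s : m n / (m <= n)%N} ->
  (forall k, exists2 i, (i < s k)%N & c k i != 0) ->
  (forall k i, (s k <= i)%N -> c k i = 0) ->
  (forall j k i, (j < k)%N -> (i < s j)%N -> c k i = 0) ->
  basic_sequence (fun k => \sum_(i < s k) c k i *: f i).
Proof.
move=> bf s_le c0 c_ge c_lt; split=> [k|a m n mn].
  have [i ik ci] := c0 k; apply: contra_neq ci => h0.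
  exact: (@basic_free f bf (s k) (c k) h0).
case: m mn => [|m] mn; first by rewrite big_ord0 normr0 mulr_ge0.
case: n mn => // n mn.
pose A i := \sum_(k < n.+1) a k * c k i.
have sumA j : (j <= n)%N -> \sum_(k < j.+1) a k *: (\sum_(i < s k) c k i *: f i) =
    \sum_(i < s j) A i *: f i.
  move=> jn.
  transitivity (\sum_(k < j.+1) \sum_(i < s j) (a k * c k i) *: f i).
    apply: eq_bigr => k _; have kj : (s k <= s j)%N by apply: s_le; rewrite -ltnS.
    rewrite (sum_widen _ _ kj) scaler_sumr; apply: eq_bigr => i _.
    by rewrite scalerA; case: ltnP => // /c_ge ->.
  rewrite exchange_big/=; apply: eq_bigr => i _; rewrite -scaler_suml; congr (_ *: _).
  rewrite /A -!(big_mkord xpredT (fun k => a k * c k i)).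
  have tail0 : \sum_(j.+1 <= k < n.+1) a k * c k i = 0.
    rewrite big_nat big1// => k /andP[jk _].
    by rewrite (c_lt _ _ _ jk)// mulr0.
  by rewrite [RHS](@big_cat_nat _ _ _ j.+1)//= tail0 addr0.
by rewrite !sumA//; case: bf => _; apply; exact: s_le.
Qed.

Lemma basic_scale f (c : nat -> R) : basic_sequence f -> (forall n, c n != 0) ->
  basic_sequence (fun n => c n *: f n).
Proof.
move=> [f0 fb] c0; split=> [n|a m n mn]; first by rewrite scaler_eq0 negb_or c0 f0.
under eq_bigr do rewrite scalerA.
under [X in _ <= _ * `|X|]eq_bigr do rewrite scalerA.
exact: (fb (fun i => a i * c i)).
Qed.

(** Mazur's construction: each new vector is almost orthogonal to the span of the previous ones. *)
Lemma basic_sequence_exists : infinite_dimensional [set: E] ->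
  exists f : nat -> E, basic_sequence f.
Proof.
move=> infE.
(* The step constants [kap n.+1 / kap n] exceed 1, and their products telescope to at most 2, since
   [kap] increases from 1 and stays below 2. *)
pose kap n : R := 2 - 2^-1 ^+ n.
have kap1 n : 1 <= kap n.
  have : (2^-1 : R) ^+ n <= 1 by rewrite exprn_ile1//; lra.
  by rewrite /kap; lra.
have kap2 n : kap n <= 2 by rewrite /kap gerBl exprn_ge0.
have kapS n : 1 < kap n.+1 / kap n.
  rewrite ltr_pdivlMr ?(lt_le_trans ltr01)// mul1r /kap exprS ltrD2l ltrN2.
  by rewrite gtr_pMl ?exprn_gt0//; lra.
pose step (s : seq E) x := `|x| = 1 /\ forall a t,
  `|\sum_(i < size s) a i *: s`_i| <=
   kap (size s).+1 / kap (size s) * `|\sum_(i < size s) a i *: s`_i + t *: x|.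
pose good (s : seq E) := forall n, (n < size s)%N -> step (take n s) s`_n.
have goodP f n : good (mkseq f n) -> (forall i, (i < n)%N -> `|f i| = 1) /\
    forall a m k, (m <= k <= n)%N -> `|\sum_(i < m) a i *: f i| <=
      kap k / kap m * `|\sum_(i < k) a i *: f i|.
  move=> gf; have st k : (k < n)%N -> `|f k| = 1 /\ forall a t,
    `|\sum_(i < k) a i *: f i| <=
     kap k.+1 / kap k * `|\sum_(i < k) a i *: f i + t *: f k|.
    move=> kn; have := gf k; rewrite size_mkseq => /(_ kn).
    rewrite nth_mkseq// /step size_take size_mkseq kn => -[f1 h]; split=> // a t.
    have E1 : \sum_(i < k) a i *: (take k (mkseq f n))`_i = \sum_(i < k) a i *: f i.
      by apply: eq_bigr => i _; rewrite nth_take// nth_mkseq// (ltn_trans _ kn).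
    by move: (h a t); rewrite E1.
  split=> [i /st[]//|a m k /andP[]].
  elim: k => [|k IHk].
    by rewrite leqn0 => /eqP->; rewrite divff ?mul1r// gt_eqF// (lt_le_trans ltr01).
  rewrite leq_eqVlt => /orP[/eqP-> _|].
    by rewrite divff ?mul1r// gt_eqF// (lt_le_trans ltr01).
  rewrite ltnS => mk kn; apply: (le_trans (IHk mk (ltnW kn))).
  have [_ /(_ a (a k))] := st _ kn; rewrite big_ord_recr/= => h.
  apply: (@le_trans _ _ (kap k / kap m * (kap k.+1 / kap k *
      `|\sum_(i < k) a i *: f i + a k *: f k|))).
    by rewrite ler_wpM2l// divr_ge0// (le_trans ler01).
  rewrite mulrA (_ : _ * (_ / _) = kap k.+1 / kap m)//.
  by rewrite mulrC mulrA divfK// gt_eqF// (lt_le_trans ltr01).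
(* Recursive choice needs an answer to every list, so the step is demanded only after good lists;
   all lists met are then shown good by induction. *)
have [f fP] : exists f : nat -> E, forall n, good (mkseq f n) ->
    step (mkseq f n) (f n).
  apply: (@history_choice _ (fun s x => good s -> step s x)) => s.
  have [gs|ngs] := pselect (good s); last by exists 0.
  pose f := nth 0 s; have sf : s = mkseq f (size s) by rewrite mkseq_nth.
  move: (gs); rewrite {1}sf => /goodP[f1 fm].
  have [|x x1 xP] := @almost_orthogonal f (size s) 4 _ infE (kapS (size s)).
    move=> a k ks; rewrite -[leLHS]mulr1 -[X in _ * X <= _](f1 k ks).
    apply: partial_sums_coef => // b m l mls; apply: (le_trans (fm _ _ _ mls)).
    rewrite ler_wpM2r// ler_pdivrMr ?(lt_le_trans ltr01)//.
    by have := kap2 l; have := kap1 m; lra.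
  by exists x.
have gf n : good (mkseq f n).
  elim: n => [[]//|n IHn] k; rewrite size_mkseq ltnS leq_eqVlt.
  move=> /orP[/eqP->|kn].
    rewrite mkseqS -cats1 take_size_cat ?size_mkseq// cats1.
    by rewrite nth_rcons size_mkseq ltnn eqxx; exact: fP.
  have := IHn k; rewrite size_mkseq => /(_ kn).
  rewrite mkseqS -cats1 takel_cat ?size_mkseq 1?ltnW//.
  by rewrite nth_cat size_mkseq kn.
have f1 n : `|f n| = 1 by have [+ _] := goodP _ _ (gf n.+1); apply.
exists f; split=> [n|a m n mn]; first by rewrite -normr_eq0 f1 oner_eq0.
have [_ /(_ a m n)] := goodP _ _ (gf n); rewrite mn leqnn => /(_ isT) h.
apply: (le_trans h); rewrite ler_wpM2r// ler_pdivrMr ?(lt_le_trans ltr01)//.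
by have := kap2 n; have := kap1 m; lra.
Qed.
End Mazur.

(** * Closed spans and isomorphisms *)

Section Closures.
Context {R : realType} {E : completeNormedModType R}.
Implicit Types (x y : E) (A X Y : set E) (f g : nat -> E) (a b : nat -> R).

Lemma submodZ X (r : R) x : submod_closed (mem X) -> X x -> X (r *: x).
Proof.
move=> [X0 Xl] Xx; rewrite -[_ *: _]addr0.
by apply/set_mem/Xl => //; exact/mem_set.
Qed.

Lemma cvg_seqP (V : normedModType R) (u : nat -> V) (l : V) : u n @[n --> \oo] --> l <->
  forall eps, 0 < eps -> exists N, forall n, (N <= n)%N -> `|l - u n| < eps.
Proof.
split=> [/cvgrPdist_lt ul eps /ul[N _ NP]|h]; first by exists N.
by apply/cvgrPdist_lt => eps /h[N NP]; exists N.
Qed.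

Lemma half_powers_small (eps : R) : 0 < eps ->
  exists N, forall n, (N <= n)%N -> 2^-1 ^+ n < eps.
Proof.
move=> e0; have /cvg_seqP/(_ _ e0)[N NP] : (2^-1 : R) ^+ n @[n --> \oo] --> (0 : R).
  by apply: cvg_expr; rewrite gtr0_norm//; lra.
by exists N => n /NP; rewrite sub0r normrN gtr0_norm// exprn_gt0//; lra.
Qed.

Lemma cauchy_seq_cvg (V : completeNormedModType R) (u : nat -> V) :
  (forall eps, 0 < eps -> exists N, forall n m, (N <= n)%N -> (N <= m)%N ->
    `|u n - u m| < eps) ->
  exists l : V, u n @[n --> \oo] --> l.
Proof.
move=> h; suff /cauchy_cvg ul : cauchy (u n @[n --> \oo]).
  by exists (lim (u n @[n --> \oo])).
apply: cauchy_exP => eps /h[N NP]; exists (u N); exists N => // n /= Nn.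
by rewrite /= -ball_normE/=; exact: NP.
Qed.

Lemma cvg_dist_le (V : normedModType R) (u : nat -> V) (l y : V) (c : R) :
  u n @[n --> \oo] --> l ->
  (exists N, forall n, (N <= n)%N -> `|u n - y| <= c) -> `|l - y| <= c.
Proof.
move=> /cvg_seqP ul [N NP]; apply/ler_addgt0Pr => eps /ul[M MP].
have h1 := ltW (MP _ (leq_maxl M N)); have h2 := NP _ (leq_maxr M N).
rewrite -(subrK (u (maxn M N)) l) -addrA.
by rewrite (le_trans (ler_normD _ _))// [c + eps]addrC lerD.
Qed.

Lemma closureP A x :
  closure A x <-> forall eps, 0 < eps -> exists2 y, A y & `|x - y| < eps.
Proof.
split=> [Ax eps e0|h B /nbhs_ballP[eps/= e0 xB]].
  have [y [Ay]] := Ax _ (nbhsx_ballx x eps e0).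
  by rewrite -ball_normE/=; exists y.
have [y Ay xy] := h _ e0; exists y; split=> //; apply: xB.
by rewrite -ball_normE.
Qed.

Lemma closed_span_submod A : submod_closed (mem (closed_span A)).
Proof.
have [S0 Sl] := lin_span_submod A; split.
  by apply/mem_set/subset_closure/set_mem.
move=> r u w /set_mem/closureP uA /set_mem/closureP wA; apply/mem_set/closureP.
move=> eps e0.
have r0 : 0 < `|r| + 1 by rewrite ltr_wpDl.
have [u' u'A uu'] := uA _ (divr_gt0 (divr_gt0 e0 (ltr0n R 2)) r0).
have [w' w'A ww'] := wA _ (divr_gt0 e0 (ltr0n R 2)).
exists (r *: u' + w'); first by apply/set_mem/Sl; exact/mem_set.
rewrite opprD addrACA -scalerBr (le_lt_trans (ler_normD _ _))// normrZ.
rewrite [ltRHS]splitr ler_ltD//.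
rewrite (@le_trans _ _ ((`|r| + 1) * `|u - u'|))//.
  by rewrite ler_wpM2r// lerDl.
by rewrite mulrC -ler_pdivlMr// ltW.
Qed.

Lemma closed_span_subspace A : closed_subspace (closed_span A).
Proof. by split; [exact: closed_span_submod|exact: closed_closure]. Qed.

Lemma sub_closed_span A : A `<=` closed_span A.
Proof. by move=> x Ax; apply: subset_closure; exact: sub_lin_span. Qed.

Lemma closed_span_min A X : closed_subspace X -> A `<=` X -> closed_span A `<=` X.
Proof.
move=> [Xs Xc] AX; rewrite [X in _ `<=` X](closure_id X).1//.
by apply: closureS; exact: lin_span_min.
Qed.

Lemma closed_span_rangeP f x : closed_span (range f) x <->
  forall eps, 0 < eps -> exists n a, `|x - \sum_(i < n) a i *: f i| < eps.
Proof.
split=> [/closureP h eps /h[y /lin_span_rangeP[n [a ->]]]|h]; first by exists n, a.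
apply/closureP => eps /h[n [a ?]]; exists (\sum_(i < n) a i *: f i) => //.
by apply/lin_span_rangeP; exists n, a.
Qed.

Lemma closed_span_scale f (c : nat -> R) : (forall n, c n != 0) ->
  closed_span (range (fun n => c n *: f n)) = closed_span (range f).
Proof.
move=> c0; apply/seteqP; split; apply: closed_span_min;
  try exact: closed_span_subspace; move=> _ [n _ <-].
  by apply: (submodZ _ (closed_span_submod _)); apply: sub_closed_span; exists n.
have -> : f n = (c n)^-1 *: (c n *: f n) by rewrite scalerA mulVf// scale1r.
by apply: (submodZ _ (closed_span_submod _)); apply: sub_closed_span; exists n.
Qed.

End Closures.

(** * Isomorphisms of spans of equivalent sequences *)

Section Isomorphisms.
Context {R : realType} {E : completeNormedModType R}.
Implicit Types (x y : E) (A X Y : set E) (f g : nat -> E) (a b : nat -> R).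

Lemma linear_on0 X T : submod_closed (mem X) -> linear_on X T -> T 0 = 0.
Proof.
move=> [X0 _] Tl; have := Tl 1 0 0 X0 X0; rewrite scale1r addr0 scale1r.
by move/eqP; rewrite -subr_eq0 opprD addrA subrr add0r oppr_eq0 => /eqP.
Qed.

Lemma linear_on_sum X T : submod_closed (mem X) -> linear_on X T ->
  forall n a f, (forall i, (i < n)%N -> X (f i)) ->
  T (\sum_(i < n) a i *: f i) = \sum_(i < n) a i *: T (f i).
Proof.
move=> Xs Tl; elim=> [|n IHn] a f Xf.
  by rewrite !big_ord0 (linear_on0 Xs Tl).
rewrite !big_ord_recr/= addrC Tl ?IHn 1?addrC//.
- by move=> i ilt; apply: Xf; rewrite ltnS ltnW.
- by apply/mem_set; exact: Xf.
- by apply/mem_set; apply: (submod_comb Xs) => i ilt; apply: Xf; rewrite ltnS ltnW.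
Qed.

Lemma continuous_linear_on_bounded X T : submod_closed (mem X) ->
  linear_on X T -> {within X, continuous T} ->
  exists2 K, 0 < K & forall x, X x -> `|T x| <= K * `|x|.
Proof.
move=> Xs Tl /subspace_continuousP Tc.
have X0 : X 0 by apply/set_mem; case: Xs.
have T0 := linear_on0 Xs Tl.
have Tc0 : T y @[y --> within X (nbhs 0)] --> T 0 by exact: Tc.
have /cvgrPdist_lt/(_ 1 ltr01) := Tc0.
rewrite T0 => /nbhs_ballP[d/= d0 dP].
exists (2 / d); first by rewrite divr_gt0.
move=> x Xx; have [->|x0] := eqVneq x 0; first by rewrite T0 !normr0 mulr0.
have n0 : 0 < `|x| by rewrite normr_gt0.
pose c := d / 2 / `|x|; have c0 : 0 < c by rewrite !divr_gt0.
have Xc : X (c *: x) by exact: submodZ.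
have TZ : T (c *: x) = c *: T x.
  have := Tl c x 0 (mem_set Xx) (mem_set X0).
  by rewrite T0 !addr0.
have : `|0 - T (c *: x)| < 1.
  apply: (dP (c *: x)) => //; rewrite -ball_normE/= sub0r normrN normrZ gtr0_norm//.
  by rewrite /c divfK ?gt_eqF// ltr_pdivrMr// ltr_pMr// ltr1n.
rewrite sub0r normrN TZ normrZ gtr0_norm// mulrC -ltr_pdivlMr// => /ltW.
by rewrite /c div1r !invf_div [`|x| * _]mulrC.
Qed.

Lemma lipschitz_within_continuous X (T : E -> E) (K : R) : 0 < K ->
  (forall x y, X x -> X y -> `|T x - T y| <= K * `|x - y|) ->
  {within X, continuous T}.
Proof.
move=> K0 TK; apply/subspace_continuousP => x Xx.
apply/cvgrPdist_lt => eps e0; apply/nbhs_ballP; exists (eps / K) => /=.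
  by rewrite divr_gt0.
move=> y; rewrite -ball_normE/= => xy Xy.
by rewrite (le_lt_trans (TK _ _ Xx Xy))// mulrC -ltr_pdivlMr.
Qed.

(* The closure of the graph of the linear map sending [f i] to [g i]. *)
Definition span_graph f g x y := forall eps, 0 < eps -> exists n a,
  `|x - \sum_(i < n) a i *: f i| < eps /\ `|y - \sum_(i < n) a i *: g i| < eps.

Lemma span_graph_linear f g (r : R) x y x' y' :
  span_graph f g x y -> span_graph f g x' y' ->
  span_graph f g (r *: x + x') (r *: y + y').
Proof.
move=> h h' eps e0.
have r0 : 0 < `|r| + 1 by rewrite ltr_wpDl.
have [n [a [ax ay]]] := h _ (divr_gt0 (divr_gt0 e0 (ltr0n R 2)) r0).
have [m [b [bx by_]]] := h' _ (divr_gt0 e0 (ltr0n R 2)).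
have [k [c [_ cP]]] := sum_lincomb r n a m b; exists k, c; rewrite !cP.
have est (u v u' v' : E) : `|u - v| < eps / 2 / (`|r| + 1) -> `|u' - v'| < eps / 2 ->
    `|r *: u + u' - (r *: v + v')| < eps.
  move=> uv uv'; rewrite opprD addrACA -scalerBr (le_lt_trans (ler_normD _ _))//.
  rewrite normrZ [ltRHS]splitr ler_ltD//.
  rewrite (@le_trans _ _ ((`|r| + 1) * `|u - v|))//.
    by rewrite ler_wpM2r// lerDl.
  by rewrite mulrC -ler_pdivlMr// ltW.
by split; exact: est.
Qed.

(** The bound on finite combinations passes to the closure. Applied to differences, it makes the
    graph single-valued and the map Lipschitz. *)
Lemma span_graph_le f g (K : R) x y : 0 < K ->
  (forall a n, `|\sum_(i < n) a i *: g i| <= K * `|\sum_(i < n) a i *: f i|) ->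
  span_graph f g x y -> `|y| <= K * `|x|.
Proof.
move=> K0 gf xy; apply/ler_addgt0Pr => eps e0.
have d0 : 0 < eps / (1 + K) by rewrite divr_gt0// addr_gt0.
have [n [a [ax ay]]] := xy _ d0.
have h := gf a n; set u := \sum_(i < n) _ *: f i in h ax.
set v := \sum_(i < n) _ *: g i in h ay.
have h1 : `|y| <= `|y - v| + `|v| by rewrite -[X in `|X| <= _](subrK v) ler_normD.
have h2 : `|u| <= `|x - u| + `|x|.
  by rewrite -[X in `|X| <= _](subrK x) (le_trans (ler_normD _ _))// distrC.
have : K * `|u| <= K * (eps / (1 + K)) + K * `|x|.
  by rewrite -mulrDr ler_pM2l//; lra.
have : eps / (1 + K) + K * (eps / (1 + K)) = eps.
  by rewrite -[X in X + _]mul1r -mulrDl mulrC divfK// gt_eqF// addr_gt0.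
lra.
Qed.

(** The combinations of [g] with the coefficients of approximants to [x] form a Cauchy sequence,
    whose limit is the image of [x]. *)
Lemma span_graph_total f g (K : R) x : 0 < K ->
  (forall a n, `|\sum_(i < n) a i *: g i| <= K * `|\sum_(i < n) a i *: f i|) ->
  closed_span (range f) x -> exists y, span_graph f g x y.
Proof.
move=> K0 gf /closed_span_rangeP xf.
have /choice[na naP] k : exists na : nat * (nat -> R),
    `|x - \sum_(i < na.1) na.2 i *: f i| < 2^-1 ^+ k.
  by have [|n [a h]] := xf (2^-1 ^+ k); [rewrite exprn_gt0|exists (n, a)].
pose u k := \sum_(i < (na k).1) (na k).2 i *: f i.
pose v k := \sum_(i < (na k).1) (na k).2 i *: g i.
have vK n m : `|v n - v m| <= K * `|u n - u m|.
  have [k [c [_ cP]]] := sum_lincomb (-1) (na m).1 (na m).2 (na n).1 (na n).2.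
  have := gf c k; rewrite !cP !scaleN1r.
  by rewrite -/(u m) -/(u n) -/(v m) -/(v n) ![- _ + _]addrC.
have [|y vy] := @cauchy_seq_cvg R E v.
  move=> eps e0; have [N NP] := half_powers_small (divr_gt0 (divr_gt0 e0 K0) (ltr0n R 2)).
  exists N => n m /NP hn /NP hm; rewrite (le_lt_trans (vK _ _))//.
  rewrite mulrC -ltr_pdivlMr//.
  have h1 := naP n; have h2 := naP m; rewrite -/(u n) -/(u m) in h1 h2.
  have : `|u n - u m| <= `|x - u n| + `|x - u m|.
    rewrite -[X in _ <= X + _](distrC (u n)) (le_trans _ (ler_normD _ _))//.
    by rewrite addrA subrK.
  lra.
exists y => eps e0; have [N NP] := half_powers_small e0; move/cvg_seqP: vy => /(_ _ e0)[M MP].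
exists (na (maxn N M)).1, (na (maxn N M)).2; split.
  by rewrite (lt_trans (naP _))// NP// leq_maxl.
by apply: MP; rewrite leq_maxr.
Qed.

(** Each bound makes the graph a bounded linear map in one direction; as the graph is symmetric in
    [f] and [g], the two maps are mutually inverse. *)
Lemma equivalent_isomorphic f g (K : R) : 0 < K ->
  (forall a n, `|\sum_(i < n) a i *: g i| <= K * `|\sum_(i < n) a i *: f i|) ->
  (forall a n, `|\sum_(i < n) a i *: f i| <= K * `|\sum_(i < n) a i *: g i|) ->
  isomorphic (closed_span (range f)) (closed_span (range g)).
Proof.
have tot (h k : nat -> E) : 0 < K ->
    (forall a n, `|\sum_(i < n) a i *: k i| <= K * `|\sum_(i < n) a i *: h i|) ->
    exists T : E -> E, [/\ forall x, closed_span (range h) x -> span_graph h k x (T x),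
     linear_on (closed_span (range h)) T &
      {within closed_span (range h), continuous T}].
  move=> K0 hk; have /choice[T TP] x : exists y, closed_span (range h) x -> span_graph h k x y.
    have [/(span_graph_total K0 hk)[y hy]|nx] := pselect (closed_span (range h) x).
      by exists y.
    by exists 0 => /nx.
  exists T; split=> //.
    (* The difference of the two sides is paired by the graph with 0, so its norm is 0. *)
    move=> r u v uX vX; apply/eqP; rewrite -subr_eq0 -normr_le0.
    have hX : closed_span (range h) (r *: u + v).
      by have [_ l] := closed_span_submod (range h); apply/set_mem/l.
    have h1 := span_graph_linear r (TP _ (set_mem uX)) (TP _ (set_mem vX)).
    have := span_graph_le K0 hk (span_graph_linear (-1) h1 (TP _ hX)).
    by rewrite !scaleN1r addNr normr0 mulr0 [- _ + _]addrC.
  apply: (lipschitz_within_continuous K0) => x y hx hy.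
  have := span_graph_le K0 hk (span_graph_linear (-1) (TP _ hy) (TP _ hx)).
  by rewrite !scaleN1r ![- _ + _]addrC.
have sym h k x y : span_graph h k x y -> span_graph k h y x.
  by move=> hk eps /hk[n [a [? ?]]]; exists n, a.
have img h k x y : span_graph h k x y -> closed_span (range k) y.
  by move=> hk; apply/closed_span_rangeP => eps /hk[n [a [_ ?]]]; exists n, a.
have uniq (h k : nat -> E) x y y' : 0 < K ->
    (forall a n, `|\sum_(i < n) a i *: k i| <= K * `|\sum_(i < n) a i *: h i|) ->
    span_graph h k x y -> span_graph h k x y' -> y = y'.
  move=> K0 hk h1 h2; apply/eqP; rewrite -subr_eq0 -normr_le0.
  have := span_graph_le K0 hk (span_graph_linear (-1) h2 h1).
  by rewrite !scaleN1r addNr normr0 mulr0 [- _ + _]addrC.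
move=> K0 gf fg; have [T [TP Tl Tc]] := tot _ _ K0 gf.
have [S [SP Sl Sc]] := tot _ _ K0 fg.
exists T, S; split=> // [x fx|y gy].
  have gT := img _ _ _ _ (TP _ fx); split=> //.
  exact: uniq K0 fg (SP _ gT) (sym _ _ _ _ (TP _ fx)).
have fS := img _ _ _ _ (SP _ gy); split=> //.
exact: uniq K0 gf (TP _ fS) (sym _ _ _ _ (SP _ gy)).
Qed.

End Isomorphisms.

(** * Schauder bases *)

Section SchauderBases.
Context {R : realType} {E : completeNormedModType R}.
Implicit Types (x y : E) (A X Y : set E) (f g : nat -> E) (a b : nat -> R).

Lemma cvg_partial_sum f (A : nat -> nat -> R) (al : nat -> R) n :
  (forall i, A k i @[k --> \oo] --> al i) ->
  \sum_(i < n) A k i *: f i @[k --> \oo] --> \sum_(i < n) al i *: f i.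
Proof.
move=> Aal; elim: n => [|n IHn].
  by under eq_fun do rewrite big_ord0; rewrite big_ord0; exact: cvg_cst.
under eq_fun do rewrite big_ord_recr/=; rewrite big_ord_recr/=.
by apply: cvgD => //; apply: cvgZr_tmp; exact: Aal.
Qed.

Lemma basic_expansion_unique f a b x : basic_sequence f ->
  series (fun n => a n *: f n) n @[n --> \oo] --> x ->
  series (fun n => b n *: f n) n @[n --> \oo] --> x -> a = b.
Proof.
move=> bf /cvg_seqP ax /cvg_seqP bx; apply/funext => k.
have fk : 0 < `|f k| by rewrite normr_gt0; case: bf => + _; apply.
apply/eqP; rewrite -subr_eq0 -normr_le0 -(pmulr_lle0 _ fk).
apply/ler_addgt0Pr => eps e0.
have [N NP] := ax _ (divr_gt0 e0 (ltr0n R 8)).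
have [M MP] := bx _ (divr_gt0 e0 (ltr0n R 8)).
pose n := maxn k.+1 (maxn N M).
have h1 := NP n (leq_trans (leq_maxl N M) (leq_maxr _ _)).
have h2 := MP n (leq_trans (leq_maxr N M) (leq_maxr _ _)).
have h3 := basic_coef bf (fun i => a i - b i) (leq_maxl k.+1 (maxn N M)).
have E1 : \sum_(i < n) (a i - b i) *: f i =
    series (fun n => a n *: f n) n - series (fun n => b n *: f n) n.
  rewrite /series/= !big_mkord -sumrB.
  by apply: eq_bigr => i _; rewrite scalerBl.
rewrite -/n E1 in h3.
have : `|series (fun n => a n *: f n) n - series (fun n => b n *: f n) n| <=
   `|x - series (fun n => a n *: f n) n| + `|x - series (fun n => b n *: f n) n|.
  rewrite -[X in _ <= X + _]distrC (le_trans _ (ler_normD _ _))//.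
  by rewrite addrA subrK.
lra.
Qed.

(** Coordinates are bounded functionals on finite combinations, so the coefficients of combinations
    approximating [x] converge; their limits give the expansion. *)
Lemma basic_expansion f x : basic_sequence f -> closed_span (range f) x ->
  exists a, series (fun n => a n *: f n) n @[n --> \oo] --> x.
Proof.
move=> bf /closed_span_rangeP xf; have [f0 fb] := bf.
have /choice[na naP] k : exists na : nat * (nat -> R),
    `|x - \sum_(i < na.1) na.2 i *: f i| < 2^-1 ^+ k.
  by have [|n [a h]] := xf (2^-1 ^+ k); [rewrite exprn_gt0|exists (n, a)].
pose A k i := if (i < (na k).1)%N then (na k).2 i else 0.
pose u k := \sum_(i < (na k).1) (na k).2 i *: f i.
have uE k n : ((na k).1 <= n)%N -> \sum_(i < n) A k i *: f i = u k.
  by move=> kn; rewrite /u (sum_widen _ _ kn).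
have uC (eps : R) : 0 < eps -> exists N, forall n m, (N <= n)%N -> (N <= m)%N ->
    `|u n - u m| < eps.
  move=> e0; have [N NP] := half_powers_small (divr_gt0 e0 (ltr0n R 2)).
  exists N => n m /NP hn /NP hm.
  have h1 := naP n; have h2 := naP m; rewrite -/(u n) -/(u m) in h1 h2.
  have : `|u n - u m| <= `|x - u n| + `|x - u m|.
    rewrite -[X in _ <= X + _](distrC (u n)) (le_trans _ (ler_normD _ _))//.
    by rewrite addrA subrK.
  lra.
(* This bound is uniform in [n], which later allows [l] to tend to infinity in a partial sum of
   fixed length. *)
have AB k l n : `|\sum_(i < n) A k i *: f i - \sum_(i < n) A l i *: f i| <=
    2 * `|u k - u l|.
  pose m := maxn n (maxn (na k).1 (na l).1).
  have := fb (fun i => A k i - A l i) n m (leq_maxl _ _).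
  under eq_bigr do rewrite scalerBl.
  under [X in _ <= _ * `|X|]eq_bigr do rewrite scalerBl.
  have mk : ((na k).1 <= m)%N := leq_trans (leq_maxl _ _) (leq_maxr _ _).
  have ml : ((na l).1 <= m)%N := leq_trans (leq_maxr _ _) (leq_maxr _ _).
  by rewrite !sumrB (uE k m mk) (uE l m ml).
have Ac i : exists al : R, A k i @[k --> \oo] --> al.
  apply: cauchy_seq_cvg => eps e0.
  have fi : 0 < `|f i| by rewrite normr_gt0.
  have [N NP] := uC _ (divr_gt0 (mulr_gt0 e0 fi) (ltr0n R 4)).
  exists N => n m nN mN; have h := NP _ _ nN mN.
  rewrite -(ltr_pM2r fi); apply: le_lt_trans (_ : 4 * `|u n - u m| < _); last by lra.
  pose l := maxn i.+1 (maxn (na n).1 (na m).1).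
  have := basic_coef bf (fun i => A n i - A m i) (leq_maxl i.+1 (maxn (na n).1 (na m).1)).
  rewrite -/l; under eq_bigr do rewrite scalerBl.
  have ln : ((na n).1 <= l)%N := leq_trans (leq_maxl _ _) (leq_maxr _ _).
  have lm : ((na m).1 <= l)%N := leq_trans (leq_maxr _ _) (leq_maxr _ _).
  by rewrite sumrB (uE n l ln) (uE m l lm).
have /choice[al alP] := Ac; exists al; apply/cvg_seqP => eps e0.
have [N NP] := uC _ (divr_gt0 e0 (ltr0n R 4)).
have [M MP] := half_powers_small (divr_gt0 e0 (ltr0n R 4)).
(* From length [(na k).1] on, the partial sum of the [k]-th approximant is the whole approximant. *)
pose k := maxn N M; exists (na k).1 => n kn.
have h1 : `|\sum_(i < n) al i *: f i - u k| <= 2 * (eps / 4).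
  rewrite -(uE k n kn).
  apply: (@cvg_dist_le R E (fun k => \sum_(i < n) A k i *: f i)).
    exact: cvg_partial_sum.
  exists N => l Nl.
  apply: (le_trans (AB _ _ _)); rewrite ler_pM2l// ltW// NP//.
  exact: leq_maxl.
have h2 : `|x - u k| < eps / 4 by apply: lt_trans (naP k) (MP _ (leq_maxr _ _)).
rewrite /series/= big_mkord.
have : `|x - \sum_(i < n) al i *: f i| <= `|x - u k| + `|\sum_(i < n) al i *: f i - u k|.
  rewrite [X in _ <= _ + X]distrC (le_trans _ (ler_normD _ _))//.
  by rewrite addrA subrK.
lra.
Qed.

Lemma basic_schauder f : basic_sequence f -> schauder_basis (closed_span (range f)) f.
Proof.
move=> bf; split=> [n|x /(basic_expansion bf)[a ax]].
  by apply: sub_closed_span; exists n.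
by exists a; split=> // b; exact: basic_expansion_unique.
Qed.

Lemma basic_closed_span f : basic_sequence f ->
  inf_closed_subspace (closed_span (range f)).
Proof.
move=> bf; split; first exact: closed_span_subspace.
apply: free_infinite_dimensional (basic_free bf) _ => n.
by apply: sub_closed_span; exists n.
Qed.

(** If a finite family spanned the kernel, adding one vector outside it would give a finite family
    spanning [X]. *)
Lemma infinite_dimensional_kernel X (phi : E -> R) : submod_closed (mem X) ->
  infinite_dimensional X ->
  (forall r x y, X x -> X y -> phi (r *: x + y) = r * phi x + phi y) ->
  infinite_dimensional (X `&` [set x | phi x = 0]).
Proof.
move=> Xs Xinf phiL [s sP]; apply: Xinf.
have [phi0|] := pselect (forall x, X x -> phi x = 0).
  by exists s => x Xx; apply: sP; split=> //; exact: phi0.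
move=> /existsNP[x0 /not_implyP[Xx0 /eqP px0]].
exists (x0 :: s) => x Xx.
pose y := - (phi x / phi x0) *: x0 + x.
have /sP ys : (X `&` [set x | phi x = 0]) y.
  split; last by rewrite /= phiL// mulNr divfK// addNr.
  by have [_ l] := Xs; apply/set_mem/l; exact/mem_set.
have -> : x = (phi x / phi x0) *: x0 + y by rewrite /y scaleNr addNKr.
have [_ l] := lin_span_submod [set` x0 :: s]; apply/set_mem/l; apply/mem_set.
  by apply: sub_lin_span; rewrite /= inE eqxx.
apply: (@lin_span_min _ _ [set` s]) ys; first exact: lin_span_submod.
by move=> z /= zs; apply: sub_lin_span; rewrite /= inE zs orbT.
Qed.

(* The first [n] coordinates are finitely many functionals, so their common
   kernel meets every infinite-dimensional subspace. *)
Lemma gliding_hump f X : basic_sequence f -> inf_closed_subspace X ->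
  X `<=` closed_span (range f) -> forall n (eps : R), 0 < eps ->
  exists x m a, [/\ X x, `|x| = 1, (forall i, (i < n)%N -> a i = 0) &
    `|x - \sum_(i < m) a i *: f i| < eps].
Proof.
move=> bf [[Xs _] Xinf] Xf n eps e0.
have /choice[c cP] x : exists a, X x -> series (fun n => a n *: f n) n @[n --> \oo] --> x.
  have [/Xf/(basic_expansion bf)[a ax]|nx] := pselect (X x); first by exists a.
  by exists (fun=> 0) => /nx.
(* The coordinates are merely chosen; uniqueness of the expansion makes them linear on [X]. *)
have cL i r x y : X x -> X y -> c (r *: x + y) i = r * c x i + c y i.
  move=> Xx Xy.
  suff -> : c (r *: x + y) = (fun i => r * c x i + c y i) by [].
  have Xz : X (r *: x + y) by have [_ l] := Xs; apply/set_mem/l; exact/mem_set.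
  apply: (basic_expansion_unique bf (cP _ Xz)).
  rewrite (_ : series _ = fun n => r *: series (fun n => c x n *: f n) n +
                             series (fun n => c y n *: f n) n).
    by apply: cvgD; [apply: cvgZl_tmp; exact: cP|exact: cP].
  apply/funext => m; rewrite /series/= scaler_sumr -big_split/=.
  by apply: eq_bigr => j _; rewrite scalerA -scalerDl.
pose K k := X `&` [set x | forall i, (i < k)%N -> c x i = 0].
have Ks k : submod_closed (mem (K k)) /\ infinite_dimensional (K k).
  elim: k => [|k [IHs IHi]].
    by rewrite (_ : K 0%N = X)//; apply/seteqP; split=> [x []//|x Xx]; split.
  have KE : K k.+1 = K k `&` [set x | c x k = 0].
    apply/seteqP; split=> x /=.
      by move=> [Xx h]; split; [split=> // i ik; apply: h; rewrite ltnS ltnW|exact: h].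
    move=> [[Xx h] h']; split=> // i; rewrite ltnS leq_eqVlt => /orP[/eqP->//|].
    exact: h.
  have cl r x y : K k x -> K k y -> c (r *: x + y) k = r * c x k + c y k.
    by move=> [Xx _] [Xy _]; exact: cL.
  split; last by rewrite KE; exact: infinite_dimensional_kernel.
  rewrite KE; have [K0 Kl] := IHs; split.
    apply/mem_set; split; first exact/set_mem.
    have := cl 1 0 0 (set_mem K0) (set_mem K0); rewrite scale1r addr0 mul1r => /eqP.
    by rewrite -subr_eq0 opprD addrA subrr sub0r oppr_eq0 => /eqP.
  move=> r x y /set_mem[Kx cx] /set_mem[Ky cy]; apply/mem_set; split.
    by apply/set_mem/Kl; exact/mem_set.
  by rewrite /= cl// cx cy mulr0 addr0.
have [x Kx x0] : exists2 x, K n x & x != 0.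
  have [_ Ki] := Ks n; apply: contrapT => h; apply: Ki; exists [::] => x Kx.
  have -> : x = 0.
    by apply/eqP/negPn/negP => x0; apply: h; exists x.
  by have [/set_mem] := lin_span_submod [set` ([::] : seq E)].
pose y := `|x|^-1 *: x.
have Ky : K n y by apply: (submodZ _ (Ks n).1).
have [Xy y0] := Ky.
have /cvg_seqP/(_ _ e0)[N NP] := cP _ Xy.
exists y, N, (c y); split=> //.
  by rewrite /y normrZ normfV normr_id mulVf// normr_eq0.
by have := NP _ (leqnn N); rewrite /series/= big_mkord.
Qed.

End SchauderBases.

(** * Block sequences with rational coefficients *)

Section Codes.
Local Notation V := {poly rat}.
Implicit Types (v w : V) (z : nat -> V).

(* A polynomial [v] stands for the vector [\sum_i v`_i *: e i], so that the
   positions of the game below form a countable type. *)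
Definition successive z := (forall k, z k != 0) /\
  forall k i, (i < size (z k))%N -> (z k.+1)`_i = 0.

Lemma successive_size z k : successive z -> (size (z k) < size (z k.+1))%N.
Proof.
move=> [z0 zs]; rewrite ltnNge; apply/negP => h.
have := z0 k.+1; rewrite -lead_coef_eq0 lead_coefE zs ?eqxx//.
by apply: leq_trans h; rewrite prednK// lt0n size_poly_eq0.
Qed.

Lemma successive_size_le z : successive z ->
  {homo (fun k => size (z k)) : k l / (k <= l)%N}.
Proof.
by move=> sz; apply: (@increasing_leq (fun k => size (z k))) => k; exact: successive_size.
Qed.

Lemma successive_coef z k l i : successive z -> (k < l)%N ->
  (i < size (z k))%N -> (z l)`_i = 0.
Proof.
move=> sz; elim: l k => // l IHl k; rewrite ltnS leq_eqVlt => /orP[/eqP->|kl] ik.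
  by case: sz => _; apply.
case: (sz) => _; apply; apply: leq_trans ik _.
by apply: (successive_size_le sz); exact: ltnW.
Qed.

Lemma successive_subsequence z (phi : nat -> nat) : successive z ->
  (forall n, (phi n < phi n.+1)%N) -> successive (z \o phi).
Proof.
move=> sz phiS; split=> [k|k i ik]; first by case: sz => + _; apply.
exact: (successive_coef sz (phiS k) ik).
Qed.

(** The sizes are positive and strictly increase, so the predecessor of [z k] has size at least
    [k]. *)
Lemma successive_coef_index z k i : successive z -> (i < k)%N -> (z k)`_i = 0.
Proof.
move=> sz; case: k => // k ik; case: (sz) => _; apply; apply: leq_trans ik _.
elim: k => [|k IHk]; last exact: leq_ltn_trans IHk (successive_size k sz).
by rewrite lt0n size_poly_eq0; case: sz.
Qed.

Lemma successive_Xn : successive (fun n => 'X^n).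
Proof.
split=> [k|k i]; first by rewrite -size_poly_eq0 size_polyXn.
by rewrite size_polyXn coefXn => ik; rewrite ltn_eqF.
Qed.

Definition span_from z n v := exists N (c : nat -> rat),
  (forall i, (i < n)%N -> c i = 0) /\ v = \sum_(i < N) c i *: z i.

Lemma span_from_linear z n (r : rat) v w :
  span_from z n v -> span_from z n w -> span_from z n (r *: v + w).
Proof.
move=> [N [c [c0 ->]]] [M [d [d0 ->]]].
have [k [b [b0 bE]]] := sum_lincomb r N c M d; rewrite -bE; exists k, b.
by split=> // i ilt; rewrite b0 ?c0 ?d0.
Qed.

Lemma span_from0 z n : span_from z n 0.
Proof. by exists 0%N, (fun=> 0); rewrite big_ord0. Qed.

Lemma span_fromD z n v w :
  span_from z n v -> span_from z n w -> span_from z n (v + w).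
Proof. by move=> vz wz; rewrite -[v]scale1r; exact: span_from_linear. Qed.

Lemma span_fromZ z n (r : rat) v : span_from z n v -> span_from z n (r *: v).
Proof.
by move=> vz; rewrite -[_ *: _]addr0; apply: span_from_linear => //; exact: span_from0.
Qed.

Lemma span_from_sum z n (I : Type) (s : seq I) (F : I -> V) :
  (forall i, span_from z n (F i)) -> span_from z n (\sum_(i <- s) F i).
Proof.
by move=> Fz; elim/big_ind: _ => //; [exact: span_from0|exact: span_fromD].
Qed.

Lemma span_from_basis z n k : (n <= k)%N -> span_from z n (z k).
Proof.
move=> nk; exists k.+1, (fun i => (i == k)%:R); split; last exact: sum_delta.
by move=> i ilt; rewrite ltn_eqF// (leq_trans ilt).
Qed.

Lemma span_from_le z n m v : (n <= m)%N -> span_from z m v -> span_from z n v.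
Proof.
move=> nm [N [c [c0 vE]]]; exists N, c; split=> // i ilt.
by apply: c0; exact: leq_trans nm.
Qed.

Lemma span_from_coef z n v i : successive z -> span_from z n v -> (i < n)%N ->
  v`_i = 0.
Proof.
move=> sz [N [c [c0 ->]]] ilt; rewrite coef_sum big1// => j _.
rewrite coefZ; have [jn|nj] := ltnP j n; first by rewrite c0// mul0r.
by rewrite successive_coef_index ?mulr0// (leq_trans ilt).
Qed.

(* Up to finitely many terms, [z'] is a sequence of blocks of [z]. *)
Definition refines z' z := forall n, exists n', forall k, (n' <= k)%N ->
  span_from z n (z' k).

Lemma refines_span z' z : refines z' z -> forall n, exists n', forall v,
  span_from z' n' v -> span_from z n v.
Proof.
move=> h n; have [n' n'P] := h n; exists n' => v [N [c [c0 ->]]].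
apply: span_from_sum => i; have [ilt|nlt] := ltnP i n'.
  by rewrite c0// scale0r; exact: span_from0.
by apply: span_fromZ; exact: n'P.
Qed.

Lemma refines_refl z : refines z z.
Proof. by move=> n; exists n => k; exact: span_from_basis. Qed.

Lemma refines_trans z1 z2 z3 : refines z1 z2 -> refines z2 z3 -> refines z1 z3.
Proof.
move=> h12 h23 n; have [m mP] := refines_span h23 n; have [l lP] := h12 m.
by exists l => k lk; apply: mP; exact: lP.
Qed.

(** Term [n] is taken from [Z n], far enough to lie in the spans from [n] of all of [Z 0], ...,
    [Z n]. *)
Lemma refines_diagonal (Z : nat -> nat -> V) :
  (forall n, successive (Z n)) -> (forall n, refines (Z n.+1) (Z n)) ->
  exists z, successive z /\ forall n, refines z (Z n).
Proof.
move=> sZ rZ.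
have rZ' i j : (i <= j)%N -> refines (Z j) (Z i).
  move=> ij; rewrite -(subnKC ij); elim: (j - i)%N => [|k IHk].
    by rewrite addn0; exact: refines_refl.
  by rewrite addnS; exact: refines_trans IHk.
have [z zP] : exists z : nat -> V, forall n, [/\ z n != 0,
    (forall v, v \in mkseq z n -> forall i, (i < size v)%N -> (z n)`_i = 0) &
    forall i, (i <= n)%N -> span_from (Z i) n (z n)].
  have [|z zP] := @history_choice _ (fun (s : seq V) x => [/\ x != 0,
    (forall v, v \in s -> forall i, (i < size v)%N -> x`_i = 0) &
    forall i, (i <= size s)%N -> span_from (Z i) (size s) x]); last first.
    by exists z => n; have := zP n; rewrite size_mkseq.
  move=> s; set n := size s.
  have /choice[m mP] i : exists m, (i <= n)%N ->
      forall k, (m <= k)%N -> span_from (Z i) n (Z n k).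
    have [ni|//] := leqP i n; last by exists 0%N.
    by have [m mP] := rZ' _ _ ni n; exists m.
  pose k := maxn (\max_(i < n.+1) m i) (\max_(v <- s) size v).
  exists (Z n k); split.
  - by case: (sZ n).
  - move=> v vs i iv; apply: successive_coef_index => //.
    apply: leq_trans iv _; apply: leq_trans (leq_maxr _ _).
    exact: leq_bigmax_seq.
  - move=> i ni; apply: mP => //; apply: leq_trans (leq_maxl _ _).
    by have := @leq_bigmax _ (fun i : 'I_n.+1 => m i) (Ordinal (ni : (i < n.+1)%N)).
exists z; split.
  split=> [k|k i ik]; first by have [] := zP k.
  have [_ h _] := zP k.+1; apply: (h (z k)) => //.
  by apply/mapP; exists k => //; rewrite mem_iota/=.
move=> i n; exists (maxn n i) => k; rewrite geq_max => /andP[nk ik].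
by have [_ _ /(_ i ik)] := zP k; exact: span_from_le.
Qed.

End Codes.

Section Evaluation.
Context {R : realType} {E : completeNormedModType R}.
Local Notation V := {poly rat}.
Implicit Types (v w : V) (z : nat -> V) (e : nat -> E).

Definition eval_code e v : E := \sum_(i < size v) ratr v`_i *: e i.

Lemma eval_codeE e v n : (size v <= n)%N ->
  eval_code e v = \sum_(i < n) ratr v`_i *: e i.
Proof.
move=> vn; rewrite /eval_code (sum_widen e (fun i => ratr v`_i) vn).
by apply: eq_bigr => i _; case: ltnP => // vi; rewrite nth_default// rmorph0.
Qed.

Lemma eval_code_linear e (r : rat) v w :
  eval_code e (r *: v + w) = ratr r *: eval_code e v + eval_code e w.
Proof.
pose n := maxn (size (r *: v + w)) (maxn (size v) (size w)).
have [h1 h2 h3] : [/\ size (r *: v + w)%R <= n, size v <= n & size w <= n]%N.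
  by rewrite /n !leq_max !leqnn !orbT.
rewrite (eval_codeE _ h1) (eval_codeE _ h2) (eval_codeE _ h3).
rewrite scaler_sumr -big_split/=; apply: eq_bigr => i _.
by rewrite coefD coefZ rmorphD rmorphM/= scalerDl scalerA.
Qed.

Lemma eval_code0 e : eval_code e 0 = 0.
Proof. by rewrite /eval_code size_poly0 big_ord0. Qed.

Lemma eval_code_sum e n (c : nat -> rat) z :
  eval_code e (\sum_(i < n) c i *: z i) =
  \sum_(i < n) ratr (c i) *: eval_code e (z i).
Proof.
elim: n => [|n IHn]; first by rewrite !big_ord0 eval_code0.
by rewrite !big_ord_recr/= addrC eval_code_linear IHn addrC.
Qed.

Lemma successive_basic e z : basic_sequence e -> successive z ->
  basic_sequence (fun n => eval_code e (z n)).
Proof.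
move=> be sz.
apply: (basic_blocks (c := fun k i => ratr (z k)`_i) (s := fun k => size (z k))) => //.
- exact: successive_size_le.
- move=> k; have z0 : (0 < size (z k))%N by rewrite lt0n size_poly_eq0; case: sz.
  exists (size (z k)).-1; first by rewrite prednK.
  by rewrite fmorph_eq0 -lead_coefE lead_coef_eq0; case: sz.
- by move=> k i ik; rewrite nth_default// rmorph0.
- by move=> j k i jk ij; rewrite (successive_coef sz jk)// rmorph0.
Qed.

(** Norms need not be rational, so normalisation takes place only after evaluation. *)
Definition normalised_code e z n := `|eval_code e (z n)|^-1 *: eval_code e (z n).

Lemma normalised_code_basic e z : basic_sequence e -> successive z ->
  basic_sequence (normalised_code e z) /\ normalised (normalised_code e z).
Proof.
move=> be sz; have bz := successive_basic be sz; have [z0 _] := bz.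
split=> [|n]; last by rewrite normrZ normfV normr_id mulVf// normr_eq0.
by apply: (basic_scale bz) => n; rewrite invr_eq0 normr_eq0.
Qed.

End Evaluation.

(** * The embedding game *)

Section TailGame.
Local Notation V := {poly rat}.
(* A position is the sequence of the moves [(F, u, K)] of the second player only:
   the first player, called the spoiler, merely restricts the choice of [F]. *)
Definition move : Type := (seq V * V * nat)%type.
Implicit Types (z : nat -> V) (p : seq move) (good : seq move -> Prop).

Definition legal z n (m : move) := forall v, v \in m.1.1 -> span_from z n v.

(** A strategy [nu] answers the moves made since [p] by the index of a tail of [z]. The spoiler wins
    once the position fails [good], hence at a finite stage. *)
Definition spoiler_wins good z p := exists nu : seq move -> nat,
  forall f : nat -> move, (forall i, legal z (nu (mkseq f i)) (f i)) ->
  exists k, ~ good (p ++ mkseq f k).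

(** The strategy transfers by answering with a tail of [z'] whose span lies in that of the
    prescribed tail of [z]. *)
Lemma spoiler_refines good z z' p : refines z' z ->
  spoiler_wins good z p -> spoiler_wins good z' p.
Proof.
move=> zz' [nu nuP]; have /choice[g gP] := refines_span zz'.
exists (g \o nu) => f fP; apply: nuP => i v vf.
by apply: gP; exact: fP.
Qed.

(** If for some [n] every legal answer [m] led to a won position, the spoiler would win from [p] by
    playing [n] and then the strategy chosen for [m]. *)
Lemma spoiler_step good z p : ~ spoiler_wins good z p -> good p /\
  forall n, exists2 m, legal z n m & ~ spoiler_wins good z (rcons p m).
Proof.
move=> nw; split.
  apply: contrapT => np; apply: nw; exists (fun=> 0%N) => f _; exists 0%N.
  by rewrite cats0.
move=> n; apply: contrapT => h; apply: nw.
have /choice[nu nuP] m : exists nu : seq move -> nat, legal z n m ->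
    forall f : nat -> move, (forall i, legal z (nu (mkseq f i)) (f i)) ->
    exists k, ~ good (rcons p m ++ mkseq f k).
  have [lm|nl] := pselect (legal z n m); last by exists (fun=> 0%N) => /nl.
  suff [nu nuP] : spoiler_wins good z (rcons p m) by exists nu.
  by apply: contrapT => nwm; apply: h; exists m.
exists (fun s => if s is m :: s' then nu m s' else n) => f fP.
have mkseqE k : mkseq f k.+1 = f 0%N :: mkseq (f \o S) k.
  by rewrite /mkseq/= -[1%N]addn0 iotaDl -map_comp; congr (_ :: _); apply: eq_map.
have [|i|k kP] := nuP (f 0%N) _ (f \o S).
- exact: (fP 0%N).
- by have := fP i.+1; rewrite mkseqE.
- by exists k.+1; rewrite mkseqE -cat_rcons.
Qed.

(** Positions are countable: one is decided at each stage by passing to a refinement, and a diagonal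
    sequence refines all stages. Both alternatives are inherited by refinements. *)
Lemma stable_exists good : exists2 z, successive z &
  forall p, spoiler_wins good z p \/
    forall z', successive z' -> refines z' z -> ~ spoiler_wins good z' p.
Proof.
pose decided z p := spoiler_wins good z p \/
    forall z', successive z' -> refines z' z -> ~ spoiler_wins good z' p.
have /choice[g gP] (nz : nat * (nat -> V)) : exists z', successive nz.2 ->
    [/\ successive z', refines z' nz.2 & forall p, pickle p = nz.1 -> decided z' p].
  case: nz => n z /=; have [sz|ns] := pselect (successive z); last by exists z.
  (* Refine to a sequence on which the spoiler wins at the position coded by [n], if one exists;
     otherwise [z] already satisfies the second alternative there. *)
  have [[z' [sz' zz' w]]|h] := pselect (exists z', [/\ successive z', refines z' z &
      forall p, pickle p = n -> spoiler_wins good z' p]).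
    by exists z' => _; split=> // p /w; left.
  exists z => _; split=> //; first exact: refines_refl.
  move=> p pn; right=> z' sz' zz' w; apply: h; exists z'; split=> // p'.
  by rewrite -pn => /(pcan_inj pickleK) ->.
pose Z := fix Z n := if n is n'.+1 then g (n', Z n') else (fun k => 'X^k) : nat -> V.
have sZ n : successive (Z n).
  by elim: n => [|n IHn]; [exact: successive_Xn|have [] := gP (n, Z n) IHn].
have rZ n : refines (Z n.+1) (Z n) by have [] := gP (n, Z n) (sZ n).
have [z [sz zZ]] := refines_diagonal sZ rZ.
exists z => // p; have [_ _ /(_ p erefl)] := gP (pickle p, Z (pickle p)) (sZ _).
move=> [w|h].
  by left; apply: spoiler_refines w; exact: (zZ (pickle p).+1).
right=> z' sz' zz'; apply: h => //.
by apply: refines_trans zz' _; exact: (zZ (pickle p).+1).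
Qed.

(* If the first player cannot win from [p] with tails of [z], then by stability
   he cannot do so with tails of any further block sequence [z'] either. *)
Lemma game_dichotomy good : exists2 z, successive z &
  spoiler_wins good z [::] \/
  exists G : seq move -> Prop, G [::] /\ forall p, G p -> good p /\
    forall z', successive z' -> refines z' z ->
    exists2 m, legal z' 0 m & G (rcons p m).
Proof.
have [z sz zP] := stable_exists good; exists z => //.
have [w|nw] := pselect (spoiler_wins good z [::]); first by left.
right; exists (fun p => ~ spoiler_wins good z p); split=> // p np.
(* A move found for [z'] stays in the set defined by [z], because a win with tails of [z] would pass
   to [z']. *)
split; first by have [] := spoiler_step np.
move=> z' sz' zz'; have [//|h] := zP p.
have [_ /(_ 0%N)[m lm nm]] := spoiler_step (h _ sz' zz').
by exists m => // w; apply: nm; exact: spoiler_refines w.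
Qed.

End TailGame.

(** * The embedding game for a fixed sequence of vectors *)

Section EmbeddingGame.
Context {R : realType} {E : completeNormedModType R}.
Local Notation V := {poly rat}.
Variable e : nat -> E.
Implicit Types (z : nat -> V) (p : seq move).

Definition pass : move := ([::], 0, 0%N).

(** The vector [y_j] is coded in the list component, because [legal] restricts only that
    component. *)
Definition source p j : V := \sum_(v <- (nth pass p j.*2.+1).1.1) v.

Definition target p j : V := (nth pass p j.*2.+2).1.2.

(* In the moves of even index the second player chooses vectors [F] and then a
   vector [u] in the span of all those chosen so far, and in the very first one
   also a constant; in the moves of odd index he chooses a vector [y]. He has to
   make the sequence of the [u] equivalent to that of the [y]. *)
Definition embedding_position p :=
  [/\ forall j, (j.*2.+1 < size p)%N -> source p j != 0,
      forall j z, (j.*2.+2 < size p)%N ->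
        (forall i v, (i <= j.+1)%N -> v \in (nth pass p i.*2).1.1 -> span_from z 0 v) ->
        span_from z 0 (target p j) &
      forall k (a : nat -> R), (k.*2 < size p)%N ->
        let c := (nth pass p 0).2%:R in
        let y := \sum_(j < k) a j *: eval_code e (source p j) in
        let u := \sum_(j < k) a j *: eval_code e (target p j) in
        `|y| <= c * `|u| /\ `|u| <= c * `|y|].

(** The exponent of 2 in [k.+1] codes a position, so every position occurs at arbitrarily large
    [k]. *)
Lemma index_recurrent (p : seq move) N :
  exists2 k, (N <= k)%N & odflt [::] (unpickle (logn 2 k.+1)) = p.
Proof.
exists (2 ^ pickle p * N.*2.+1).-1.
  rewrite -ltnS prednK ?muln_gt0 ?expn_gt0//.
  rewrite (@leq_trans N.*2.+1)// ?ltnS -?addnn ?leq_addr//.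
  by rewrite leq_pmull// expn_gt0.
rewrite prednK ?muln_gt0 ?expn_gt0// lognM ?expn_gt0// pfactorK//.
rewrite [X in (_ + X)%N](_ : _ = 0%N) ?addn0 ?pickleK//.
by rewrite lognE/= dvdn2/= odd_double.
Qed.

(** The term [x k] answers the position [q k]. Against [y], the even moves are played in [y] and the
    odd ones are answers already listed in [x], at ever larger indices since each position
    recurs. *)
Lemma subsequence_embedding z (G : seq move -> Prop) : successive z -> G [::] ->
  (forall p, G p -> embedding_position p /\
    forall z', successive z' -> refines z' z ->
    exists2 m, legal z' 0 m & G (rcons p m)) ->
  exists x, [/\ successive x, refines x z & forall y, successive y -> refines y z ->
    exists (phi : nat -> nat) (u : nat -> V) (K : R), [/\ increasing_seq phi, 0 < K,
      forall j, span_from y 0 (u j) &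
      forall k (a : nat -> R),
        let x' := \sum_(j < k) a j *: eval_code e (x (phi j)) in
        let u' := \sum_(j < k) a j *: eval_code e (u j) in
        `|x'| <= K * `|u'| /\ `|u'| <= K * `|x'| ] ].
Proof.
move=> sz G0 GP; pose q k := odflt [::] (unpickle (logn 2 k.+1)) : seq move.
have [|x xP] := @history_choice V (fun s v => [/\ v != 0,
    (forall w, w \in s -> forall i, (i < size w)%N -> v`_i = 0),
    span_from z (size s) v &
    G (q (size s)) -> odd (size (q (size s))) ->
    exists2 m, G (rcons (q (size s)) m) & \sum_(w <- m.1.1) w = v ]).
  move=> s; set n := size s; pose N := maxn n (\max_(w <- s) size w).
  have sN w : w \in s -> (size w <= N)%N.
    by move=> ws; apply: leq_trans (leq_maxr _ _); exact: leq_bigmax_seq.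
  (* Tails of [z] are themselves refinements of [z], so [G] supplies an answer beyond all the
     earlier terms. *)
  have tz : successive (fun k => z (N + k)%N).
    by split=> [k|k i]; [case: sz|rewrite addnS; case: sz => _; apply].
  have rz : refines (fun k => z (N + k)%N) z.
    by move=> l; exists l => k lk; apply: span_from_basis; rewrite (leq_trans lk)// leq_addl.
  (* At positions outside [G], or where no [y] is due, the term [z N] is a filler keeping the
     sequence successive. *)
  have [[Gq oq]|nG] := pselect (G (q n) /\ odd (size (q n))); last first.
    exists (z N); split; first by case: sz.
    - by move=> w /sN wN i iw; rewrite successive_coef_index// (leq_trans iw).
    - by apply: span_from_basis; exact: leq_maxl.
    - by move=> Gq oq; case: nG.
  have [_ /(_ _ tz rz)[m lm Gm]] := GP _ Gq.
  have mN : span_from z N (\sum_(w <- m.1.1) w).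
    rewrite big_seq; elim/big_ind: _ => [|v w|w /lm[l [c [_ ->]]]].
    - exact: span_from0.
    - exact: span_fromD.
    - apply: span_from_sum => i; apply: span_fromZ; apply: span_from_basis.
      exact: leq_addr.
  exists (\sum_(w <- m.1.1) w); split.
  - have [[+ _ _] _] := GP _ Gm; move=> /(_ (size (q n))./2).
    rewrite /source.
    have -> : (size (q n))./2.*2.+1 = size (q n).
      by rewrite -[RHS]odd_double_half oq.
    by rewrite size_rcons ltnSn nth_rcons ltnn eqxx => /(_ isT).
  - by move=> w /sN wN i iw; rewrite (span_from_coef sz mN)// (leq_trans iw).
  - by apply: span_from_le mN; exact: leq_maxl.
  - by move=> _ _; exists m.
exists x; split.
- split=> [k|k i ik]; first by have [] := xP k.
  have [_ h _ _] := xP k.+1; apply: (h (x k)) => //.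
  by apply/mapP; exists k => //; rewrite mem_iota/=.
- move=> n; exists n => k nk; have [_ _ h _] := xP k.
  by rewrite size_mkseq in h; exact: span_from_le h.
move=> y sy yz.
pose flat (s : seq (move * move * nat)) := flatten [seq [:: t.1.1; t.1.2] | t <- s].
have flat_rcons s t : flat (rcons s t) = rcons (rcons (flat s) t.1.1) t.1.2.
  by rewrite /flat map_rcons flatten_rcons -!cats1 -catA.
have size_flat s : size (flat s) = (size s).*2.
  by elim/last_ind: s => // s t IH; rewrite flat_rcons !size_rcons IH.
(* A round consists of an even move, the following odd move, and the index in [x] at which the
   latter is listed. *)
have [|F FP] := @history_choice _ (fun s t => G (flat s) ->
    [/\ legal y 0 t.1.1, G (rcons (rcons (flat s) t.1.1) t.1.2),
        \sum_(w <- t.1.2.1.1) w = x t.2 & forall t', t' \in s -> (t'.2 < t.2)%N]).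
  move=> s; have [Gs|nG] := pselect (G (flat s)); last by exists (pass, pass, 0%N) => /nG.
  have [_ /(_ _ sy yz)[m lm Gm]] := GP _ Gs.
  have [k Nk qk] := index_recurrent (rcons (flat s) m) (\max_(t <- s) t.2).+1.
  have [_ _ _] := xP k; rewrite size_mkseq /q qk => /(_ Gm).
  rewrite size_rcons size_flat/= odd_double => /(_ isT)[m' Gm' m'x].
  exists (m, m', k) => _; split=> // t ts; apply: leq_trans Nk.
  by rewrite ltnS; apply: (@leq_bigmax_seq _ _ xpredT (fun t => t.2)).
have GF n : G (flat (mkseq F n)).
  by elim: n => // n IHn; rewrite mkseqS flat_rcons; have [] := FP n IHn.
have nthF n j : (j < n)%N -> nth pass (flat (mkseq F n)) j.*2 = (F j).1.1 /\
    nth pass (flat (mkseq F n)) j.*2.+1 = (F j).1.2.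
  elim: n => // n IHn; rewrite ltnS mkseqS flat_rcons => jn.
  rewrite !nth_rcons size_rcons size_flat size_mkseq.
  move: jn; rewrite leq_eqVlt => /orP[/eqP->|jn].
    by rewrite ltnn ltnS leqnn eqxx ltnn eqxx.
  have j1 : (j.*2 < n.*2)%N by rewrite ltn_double.
  have j2 : (j.*2.+1 < n.*2)%N by lia.
  by rewrite j1 j2 !ltnS (ltnW j1) (ltnW j2); exact: IHn.
have sizeF n : size (flat (mkseq F n)) = n.*2 by rewrite size_flat size_mkseq.
(* The vector [u_j] belongs to the even move of round [j.+1], and the constant to that of round 0;
   adding 1 makes it positive. *)
exists (fun j => (F j).2), (fun j => (F j.+1).1.1.1.2), ((F 0%N).1.1.2%:R + 1); split.
- apply/increasing_seqP => n; have [_ _ _] := FP n.+1 (GF _); apply.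
  by apply/mapP; exists n => //; rewrite mem_iota/=.
- by rewrite ltr_wpDl.
- move=> j; have [[_ + _] _] := GP _ (GF j.+2).
  move=> /(_ j y); rewrite sizeF -doubleS ltn_double ltnSn => /(_ isT).
  rewrite /target -doubleS (nthF _ _ (ltnSn j.+1)).1; apply.
  move=> i v ij; rewrite (nthF _ _ (ij : (i < j.+2)%N)).1.
  by have [ly _ _ _] := FP i (GF i); exact: ly.
- move=> k a; have [[_ _ +] _] := GP _ (GF k.+1).
  move=> /(_ k a); rewrite sizeF ltn_double ltnSn (nthF k.+1 0%N _).1// => /(_ isT).
  set c := _%:R => /=.
  have -> : \sum_(j < k) a j *: eval_code e (source (flat (mkseq F k.+1)) j) =
      \sum_(j < k) a j *: eval_code e (x (F j).2).
    apply: eq_bigr => j _; rewrite /source (nthF k.+1 j _).2; last by rewrite ltnS ltnW.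
    by have [_ _ -> _] := FP j (GF j).
  have -> : \sum_(j < k) a j *: eval_code e (target (flat (mkseq F k.+1)) j) =
      \sum_(j < k) a j *: eval_code e (F j.+1).1.1.1.2.
    by apply: eq_bigr => j _; rewrite /target -doubleS (nthF k.+1 j.+1 _).1// ltnS.
  move=> [h1 h2]; split; rewrite mulrDl mul1r.
    by rewrite (le_trans h1)// lerDl.
  by rewrite (le_trans h2)// lerDl.
Qed.

End EmbeddingGame.

(** * Subsequential minimality *)

Section SubsequentialMinimality.
Context {R : realType} {E : completeNormedModType R}.
Local Notation V := {poly rat}.
Implicit Types (e f g : nat -> E) (a b : nat -> R).

Lemma sum_half_powers n : \sum_(i < n) (2^-1 : R) ^+ i = 2 - 2 * 2^-1 ^+ n.
Proof.
elim: n => [|n IHn]; first by rewrite big_ord0 expr0; lra.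
by rewrite big_ord_recr/= IHn exprS; lra.
Qed.

(** The coefficient bound contributes a factor 4 and the sum of the powers of 1/2 a factor 2. *)
Lemma basic_perturbation f (d : nat -> E) (eta : R) : basic_sequence f -> 0 <= eta ->
  (forall i, `|d i| <= 2^-1 ^+ i * (eta * `|f i|)) ->
  forall b n, `|\sum_(i < n) b i *: d i| <= 8 * eta * `|\sum_(i < n) b i *: f i|.
Proof.
move=> bf eta0 df b n; set s := `|\sum_(i < n) b i *: f i|.
have s0 : 0 <= s by exact: normr_ge0.
apply: (@le_trans _ _ (\sum_(i < n) 2^-1 ^+ i * (eta * (4 * s)))).
  rewrite (le_trans (ler_norm_sum _ _ _))// ler_sum// => i _; rewrite normrZ.
  have h1 := basic_coef bf b (ltn_ord i); have h2 := df i.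
  rewrite (le_trans (ler_wpM2l (normr_ge0 _) h2))// mulrCA ler_wpM2l ?exprn_ge0//.
  by rewrite mulrCA ler_wpM2l.
rewrite -mulr_suml sum_half_powers.
have : (2 - 2 * 2^-1 ^+ n) * (eta * (4 * s)) <= 2 * (eta * (4 * s)).
  by rewrite ler_wpM2r ?mulr_ge0// gerBl mulr_ge0// exprn_ge0.
by rewrite [8 * eta * s](_ : _ = 2 * (eta * (4 * s)))//; lra.
Qed.

(** Zero is rounded to zero, so that rounding never enlarges a support. *)
Lemma rational_approximation (c eps : R) : 0 < eps ->
  exists q : rat, `|c - ratr q| <= eps /\ (c = 0 -> q = 0).
Proof.
move=> e0; have [->|c0] := eqVneq c 0.
  by exists 0; rewrite rmorph0 subrr normr0 ltW.
have [D DP] := rational_grid `|c| e0; have [q _ cq] := DP c (lexx _).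
by exists q; split=> // /eqP; rewrite (negbTE c0).
Qed.

Lemma rational_combination e (x : nat -> V) m a (eps : R) : 0 < eps ->
  exists c : nat -> rat, (forall i, a i = 0 -> c i = 0) /\
    `|\sum_(i < m) a i *: eval_code e (x i) -
      eval_code e (\sum_(i < m) c i *: x i)| <= eps.
Proof.
move=> e0; pose S := 1 + \sum_(i < m) `|eval_code e (x i)|.
have S0 : 0 < S by rewrite ltr_pwDl// sumr_ge0.
have S1 : \sum_(i < m) `|eval_code e (x i)| <= S by rewrite lerDr.
have /choice[c cP] i := rational_approximation (a i) (divr_gt0 e0 S0).
exists c; split=> [i|]; first by case: (cP i).
rewrite eval_code_sum -sumrB (le_trans (ler_norm_sum _ _ _))//.
apply: (@le_trans _ _ (eps / S * \sum_(i < m) `|eval_code e (x i)|)).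
  rewrite mulr_sumr ler_sum// => i _.
  by rewrite -scalerBl normrZ ler_wpM2r//; case: (cP i).
by rewrite -ler_pdivlMl ?divr_gt0// invf_div divfK// gt_eqF.
Qed.

(** Gliding hump vectors of [Y] are rounded to rational blocks. The factor [16^-1] makes the total
    perturbation at most one half of the norm. *)
Lemma block_approximation e (x : nat -> V) (Y : set E) :
  basic_sequence e -> successive x -> inf_closed_subspace Y ->
  Y `<=` closed_span (range (fun n => eval_code e (x n))) ->
  exists (y : nat -> V) (w : nat -> E), [/\ successive y, refines y x,
    forall n, Y (w n) &
    forall n, `|w n - eval_code e (y n)| <=
      2^-1 ^+ n * (16^-1 * `|eval_code e (y n)|)].
Proof.
move=> be sx Yi Yx; have bx := successive_basic be sx.
have est (P r : R) : P / 2 <= r -> 2 * (P / 64) <= 16^-1 * r by lra.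
have [|F FP] := @history_choice (V * E) (fun s t => [/\ t.1 != 0,
    (forall t', t' \in s -> forall i, (i < size t'.1)%N -> t.1`_i = 0),
    span_from x (size s) t.1, Y t.2 & `|t.2 - eval_code e t.1| <=
      2^-1 ^+ size s * (16^-1 * `|eval_code e t.1|)]).
  move=> s; set n := size s; pose N := maxn n (\max_(k <- [seq size (t.1 : V) | t : V * E <- s]) k).
  have sN t : t \in s -> (size t.1 <= N)%N.
    move=> ts; apply: leq_trans (leq_maxr _ _).
    apply: (@leq_bigmax_seq _ _ xpredT id) => //.
    exact: (map_f (fun t : V * E => size (t.1 : V)) ts).
  (* The total error is [2 * d], and the block keeps norm at least 1/2, whence 64. *)
  pose d : R := 2^-1 ^+ n / 64.
  have d0 : 0 < d by rewrite divr_gt0// exprn_gt0.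
  have d1 : d <= 1 / 64.
    by rewrite ler_pM2r ?invr_gt0// exprn_ile1//; lra.
  have [w [m [a [Yw w1 aN wa]]]] := gliding_hump bx Yi Yx N d0.
  have [c [c0 cP]] := rational_combination e x m a d0.
  set v := \sum_(i < m) c i *: x i in cP.
  have wv : `|w - eval_code e v| <= 2 * d.
    rewrite -(subrK (\sum_(i < m) a i *: eval_code e (x i)) w) -addrA.
    by rewrite (le_trans (ler_normD _ _))// mulr2n mulrDl !mul1r lerD// ltW.
  have v1 : 2^-1 <= `|eval_code e v|.
    have : `|w| <= `|w - eval_code e v| + `|eval_code e v|.
      by rewrite -[X in `|X| <= _](subrK (eval_code e v)) ler_normD.
    by rewrite w1; lra.
  have vN : span_from x N v by exists m, c; split=> // i /aN; exact: c0.
  exists (v, w); split=> //=.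
  - apply/eqP => v0; move: v1; rewrite v0 eval_code0 normr0; lra.
  - by move=> t /sN tN i it; rewrite (span_from_coef sx vN)// (leq_trans it).
  - by apply: span_from_le vN; exact: leq_maxl.
  - rewrite (le_trans wv)// /d.
    have : 2^-1 ^+ n * 2^-1 <= 2^-1 ^+ n * `|eval_code e v|.
      by rewrite ler_wpM2l// exprn_ge0.
    by move=> /est; rewrite (mulrCA 16^-1).
exists (fun n => (F n).1), (fun n => (F n).2); split.
- split=> [k|k i ik]; first by have [] := FP k.
  have [_ h _ _ _] := FP k.+1; apply: (h (F k)) => //.
  by apply/mapP; exists k => //; rewrite mem_iota/=.
- move=> n; exists n => k nk; have [_ _ + _ _] := FP k.
  by rewrite size_mkseq; exact: span_from_le.
- by move=> n; have [] := FP n.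
- by move=> n; have [] := FP n; rewrite size_mkseq.
Qed.

(** Replacing the blocks [y i] by the nearby [w i] turns each [u j] into a vector [w' j] of [Y]. The
    sequence [w'] is equivalent to [u], hence to a subsequence of [x]; scaling by [lam] does not
    change spans. *)
Lemma embedding_subsequentially_minimal e (z x : nat -> V) (lam : nat -> R) :
  basic_sequence e -> successive x -> refines x z -> (forall n, lam n != 0) ->
  (forall y, successive y -> refines y z ->
    exists (phi : nat -> nat) (u : nat -> V) (K : R), [/\ increasing_seq phi, 0 < K,
      forall j, span_from y 0 (u j) &
      forall k a,
        let x' := \sum_(j < k) a j *: eval_code e (x (phi j)) in
        let u' := \sum_(j < k) a j *: eval_code e (u j) in
        `|x'| <= K * `|u'| /\ `|u'| <= K * `|x'| ]) ->
  subsequentially_minimal (fun n => lam n *: eval_code e (x n)).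
Proof.
move=> be sx xz lam0 xP Y Yi; rewrite (closed_span_scale _ lam0) => Yx.
have [[Ys Yc] _] := Yi.
have [y [w [sy yx Yw wy]]] := block_approximation be sx Yi Yx.
have by_ := successive_basic be sy.
have [phi [u [K [phiI K0 uy uK]]]] := xP y sy (refines_trans yx xz).
exists phi; split=> //.
have /choice[N /choice[c cP]] j : exists N, exists c : nat -> rat,
    u j = \sum_(i < N) c i *: y i by have [N [c [_ ->]]] := uy j; exists N, c.
pose w' j := \sum_(i < N j) ratr (c j i) *: w i.
exists (closed_span (range w')); split.
- exact: closed_span_subspace.
- apply: closed_span_min => // _ [j _ <-].
  exact: (submod_comb Ys (fun i => ratr (c j i)) (fun i (_ : (i < N j)%N) => Yw i)).
have -> : (fun n => lam n *: eval_code e (x n)) \o phi =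
    (fun j => lam (phi j) *: eval_code e (x (phi j))) by [].
rewrite (closed_span_scale (fun j => eval_code e (x (phi j)))) => [|j]; last exact: lam0.
have pert b n : `|\sum_(i < n) b i *: w i - \sum_(i < n) b i *: eval_code e (y i)| <=
    2^-1 * `|\sum_(i < n) b i *: eval_code e (y i)|.
  have := @basic_perturbation _ (fun i => w i - eval_code e (y i)) 16^-1 by_ _ wy b n.
  under eq_bigr do rewrite scalerBr.
  by rewrite sumrB (_ : 8 * 16^-1 = 2^-1) => [|]; [apply; lra|lra].
have uw a k : `|\sum_(j < k) a j *: w' j - \sum_(j < k) a j *: eval_code e (u j)| <=
    2^-1 * `|\sum_(j < k) a j *: eval_code e (u j)|.
  (* Combinations of the [u j] are rewritten, with padding by zeros, as combinations of the [y i],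
     to which the perturbation bound applies. *)
  pose M := \max_(j < k) N j.
  pose C j i : R := if (i < N j)%N then ratr (c j i) else 0.
  pose B i := \sum_(j < k) a j * C j i.
  have CE (g : nat -> E) (j : 'I_k) :
      \sum_(i < N j) ratr (c j i) *: g i = \sum_(i < M) C j i *: g i.
    have jM : (N j <= M)%N by exact: (@leq_bigmax _ (fun j : 'I_k => N j)).
    exact: (sum_widen g (fun i => ratr (c j i)) jM).
  have BE (g : nat -> E) : \sum_(j < k) a j *: (\sum_(i < N j) ratr (c j i) *: g i) =
      \sum_(i < M) B i *: g i.
    under eq_bigr do rewrite CE scaler_sumr.
    rewrite exchange_big/=; apply: eq_bigr => i _.
    by rewrite /B scaler_suml; apply: eq_bigr => j _; rewrite scalerA.
  rewrite /w' BE.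
  have -> : \sum_(j < k) a j *: eval_code e (u j) = \sum_(i < M) B i *: eval_code e (y i).
    rewrite -(BE (fun i => eval_code e (y i))).
    by apply: eq_bigr => j _; rewrite cP eval_code_sum.
  exact: pert.
(* The perturbation gives [|w'| <= 3/2 * |u|] and [|u| <= 2 * |w'|] for corresponding sums, so the
   factor 2 suffices both ways. *)
apply: (@equivalent_isomorphic _ _ _ _ (2 * K)) => [|a n|a n]; first by rewrite mulr_gt0.
- have [h1 h2] := uK n a; have h3 := uw a n; rewrite /= in h1 h2.
  set s := \sum_(j < n) _ *: w' _ in h3 *; set t := \sum_(j < n) _ *: eval_code e (u _) in h2 h3.
  have : `|s| <= `|s - t| + `|t| by rewrite -[X in `|X| <= _](subrK t) ler_normD.
  have := normr_ge0 t; rewrite -mulrA; lra.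
- have [h1 h2] := uK n a; have h3 := uw a n; rewrite /= in h1 h2.
  set s := \sum_(j < n) _ *: w' _ in h3 *; set t := \sum_(j < n) _ *: eval_code e (u _) in h1 h3.
  rewrite (le_trans h1)// (mulrC 2) -mulrA ler_pM2l//.
  have : `|t| <= `|s - t| + `|s|.
    by rewrite -[X in `|X| <= _](subrK s) (le_trans (ler_normD _ _))// distrC.
  have := normr_ge0 t; lra.
Qed.

End SubsequentialMinimality.

(** * Tightness by range *)

Section Grids.
Context {R : realType} {E : completeNormedModType R}.
Local Notation V := {poly rat}.
Implicit Types (z : nat -> V) (D : nat -> seq rat) (phi : nat -> nat).

Lemma finite_bounded_seq (T : choiceType) (A : set T) n : finite_set A ->
  finite_set [set s : seq T | (size s <= n)%N /\ forall x, x \in s -> A x].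
Proof.
move=> fA; elim: n => [|n IHn].
  apply: (@sub_finite_set _ _ [set [::]]) => [s [+ _]|]; last exact: finite_set1.
  by rewrite leqn0 size_eq0 => /eqP.
apply: (@sub_finite_set _ _ ([set [::]] `|` (fun xs => xs.1 :: xs.2) @`
    (A `*` [set s : seq T | (size s <= n)%N /\ forall x, x \in s -> A x]))).
  move=> [|x s] [/= sn sA]; first by left.
  right; exists (x, s) => //; split=> /=; first by apply: sA; rewrite inE eqxx.
  by split=> // y ys; apply: sA; rewrite inE ys orbT.
by rewrite finite_setU; split; [exact: finite_set1|exact/finite_image/finite_setX].
Qed.

Lemma finite_set_bound (T : choiceType) (A : set T) (g : T -> nat) : finite_set A ->
  exists B, forall x, A x -> (g x <= B)%N.
Proof.
move=> /finite_seqP[s ->]; exists (\max_(k <- map g s) k) => x /= xs.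
by apply: (@leq_bigmax_seq _ _ xpredT id); rewrite // map_f.
Qed.

(** Here [r k] stands for the norm of the [k]-th vector, so that [ratr q * r k] is the coefficient
    after normalisation. The entries 0 and 1 make padding and the basis vectors themselves
    available. *)
Lemma coefficient_grid (r : nat -> R) : (forall k, 0 < r k) -> exists D,
  [/\ forall N, 0 \in D N, forall N, 1 \in D N,
      forall N, {subset D N <= D N.+1} &
      forall N k c, (k <= N)%N -> `|c| <= N.+1%:R -> exists q,
        [/\ q \in D N, c = 0 -> q = 0 & `|c - ratr q * r k| <= 4^-1 ^+ N] ].
Proof.
move=> r0.
have /choice[D0 D0P] (Nk : nat * nat) : exists D0 : seq rat, forall c : R,
    `|c| <= Nk.1.+1%:R / r Nk.2 -> exists2 q, q \in D0 &
      `|c - ratr q| <= 4^-1 ^+ Nk.1 / r Nk.2.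
  by apply: rational_grid; rewrite divr_gt0// exprn_gt0.
pose D1 N := 0 :: 1 :: flatten [seq D0 (N, k) | k <- iota 0 N.+1].
pose D N := flatten [seq D1 M | M <- iota 0 N.+1].
have DS N : D N.+1 = D N ++ D1 N.+1.
  rewrite /D -[N.+2]addn1 iotaD map_cat flatten_cat; congr (_ ++ _).
  by rewrite add0n /= cats0.
have D1D N : {subset D1 N <= D N}.
  case: N => [|N] q qD; first by rewrite /D /= cats0.
  by rewrite DS mem_cat qD orbT.
exists D; split.
- by move=> N; apply: D1D; rewrite inE eqxx.
- by move=> N; apply: D1D; rewrite !inE eqxx orbT.
- by move=> N q qD; rewrite DS mem_cat qD.
move=> N k c kN cN; have [->|c0] := eqVneq c 0.
  exists 0; split=> //.
  by rewrite rmorph0 mul0r subrr normr0 exprn_ge0.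
have [|q qD cq] := D0P (N, k) (c / r k).
  by rewrite normrM normfV (gtr0_norm (r0 k)) ler_pM2r// invr_gt0.
exists q; split.
- apply: D1D; rewrite !inE; apply/orP; right; apply/orP; right.
  by apply/flattenP; exists (D0 (N, k)) => //; apply/mapP; exists k; rewrite ?mem_iota.
- by move/eqP; rewrite (negbTE c0).
- have -> : c - ratr q * r k = (c / r k - ratr q) * r k.
    by rewrite mulrBl divfK// gt_eqF.
  by rewrite normrM (gtr0_norm (r0 k)) -ler_pdivlMr.
Qed.

(** The grid is [D (phi n)] because the largest index of [z] involved is [phi n]. *)
Definition grid_vector D z phi n v := exists q : nat -> rat,
  (forall k, (k <= n)%N -> q k \in D (phi n)) /\ v = \sum_(k < n.+1) q k *: z (phi k).

Definition grid_move D z phi n (m : move) := [/\ (size m.1.1 <= n.+1)%N,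
  forall v, v \in m.1.1 -> grid_vector D z phi n v,
  grid_vector D z phi n m.1.2 & (m.2 <= n)%N].

(* There are finitely many plays all of whose vectors are taken from a grid in
   the span of [z (phi 0), ..., z (phi n)], so that [phi n.+1] may exceed all
   the answers of a given strategy [nu] to them. *)
Lemma strategy_bound D z (nu : seq move -> nat) : (forall N, {subset D N <= D N.+1}) ->
  exists phi, [/\ forall n, (phi n < phi n.+1)%N, (nu [::] <= phi 0)%N &
    forall n p, (size p <= 4 * n.+1)%N -> (forall m, m \in p -> grid_move D z phi n m) ->
    (nu p <= phi n.+1)%N].
Proof.
move=> DS.
(* These finite sets depend only on the number [N] and not on [phi], so the bound at [N = phi n] can
   be used to define [phi n.+1]. *)
pose A N := [set l : seq (nat * rat) | (size l <= N.+1)%N /\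
  forall t, t \in l -> (`I_N.+1 `*` [set` D N]) t].
pose VN N : set V := (fun l => \sum_(t <- l) t.2 *: z t.1) @` A N.
have fV N : finite_set (VN N).
  by apply/finite_image/finite_bounded_seq/finite_setX; [exact: finite_II|exact: finite_seq].
pose MN N : set move :=
  ([set s : seq V | (size s <= N.+1)%N /\ forall v, v \in s -> VN N v] `*` VN N) `*` `I_N.+1.
have fM N : finite_set (MN N).
  apply: finite_setX; last exact: finite_II.
  by apply: finite_setX; first exact: finite_bounded_seq.
have /choice[psi psiP] N : exists B, forall p : seq move,
    (size p <= 4 * N.+1)%N /\ (forall m, m \in p -> MN N m) -> (nu p <= B)%N.
  exact: (finite_set_bound nu (finite_bounded_seq (4 * N.+1) (fM N))).
pose phi := fix phi n := if n is n'.+1 then maxn (psi (phi n')) (phi n').+1 else nu [::].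
have phiS n : (phi n < phi n.+1)%N by exact: leq_maxr.
have phin n : (n <= phi n)%N by elim: n => // n IHn; exact: leq_ltn_trans IHn (phiS n).
have phi_le := increasing_leq phiS.
have gV n v : grid_vector D z phi n v -> VN (phi n) v.
  move=> [q [qD ->]]; exists [seq (phi k, q k) | k <- iota 0 n.+1].
    split; first by rewrite size_map size_iota ltnS.
    move=> t /mapP[k]; rewrite mem_iota add0n ltnS /= => kn ->; split=> /=.
      by rewrite ltnS phi_le.
    exact: qD.
  by rewrite big_map -(big_mkord xpredT (fun k => q k *: z (phi k))).
exists phi; split=> // n p pn pM; apply: leq_trans (leq_maxl _ _).
apply: psiP; split; first by apply: (leq_trans pn); rewrite leq_mul2l/= ltnS.
move=> m /pM[h1 h2 h3 h4]; split; first split; rewrite /=.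
- by split; [apply: leq_trans h1 _; rewrite ltnS|move=> v /h2/gV].
- exact: gV.
- by rewrite ltnS (leq_trans h4).
Qed.

Lemma grid_vector_le D z phi n m v : (forall N, 0 \in D N) ->
  (forall N, {subset D N <= D N.+1}) -> (forall n, (phi n < phi n.+1)%N) ->
  (n <= m)%N -> grid_vector D z phi n v -> grid_vector D z phi m v.
Proof.
move=> D0 DS phiS nm [q [qD ->]].
have D_le k l : (k <= l)%N -> {subset D k <= D l}.
  elim: l => [|l IHl]; first by rewrite leqn0 => /eqP->.
  by rewrite leq_eqVlt => /orP[/eqP->//|/IHl kl] r /kl/DS.
have phi_le := increasing_leq phiS.
exists (fun k => if (k <= n)%N then q k else 0); split.
  by move=> k km; case: ifP => // kn; apply: D_le (qD _ kn); exact: phi_le.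
exact: (sum_widen (z \o phi)).
Qed.

Lemma grid_move_le D z phi n m t : (forall N, 0 \in D N) ->
  (forall N, {subset D N <= D N.+1}) -> (forall n, (phi n < phi n.+1)%N) ->
  (n <= m)%N -> grid_move D z phi n t -> grid_move D z phi m t.
Proof.
move=> D0 DS phiS nm [h1 h2 h3 h4]; split.
- by apply: leq_trans h1 _; rewrite ltnS.
- by move=> v /h2; exact: grid_vector_le.
- exact: grid_vector_le h3.
- exact: leq_trans h4 nm.
Qed.

End Grids.

(** * Perturbations and plays against a strategy *)

Section Tightness.
Context {R : realType} {E : completeNormedModType R}.
Local Notation V := {poly rat}.
Implicit Types (a : nat -> R) (e f : nat -> E) (z : nat -> V) (D : nat -> seq rat).
Implicit Types (phi : nat -> nat).

(** Here [s], [T], [Y], [U] stand for the norms of one combination of [b], [t], [y], [u], and [r]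
    for [s / K]. *)
Lemma perturbation_estimate (K r s T Y U : R) : 1 <= K -> 0 <= r -> r <= s ->
  K * r = s -> r <= T -> T <= K * s -> Y <= 4^-1 * r + s -> s <= 4^-1 * r + Y ->
  U <= 2^-1 * r + T -> T <= 2^-1 * r + U -> Y <= 3 * K * U /\ U <= 3 * K * Y.
Proof.
move=> K1 r0 rs Kr rT TK Ys sY UT TU.
have K0 : 0 < K by lra.
have UB : 2^-1 * r <= U by lra.
have YB : 2^-1 * s <= Y by lra.
have KU : 2^-1 * (K * r) <= K * U by rewrite mulrCA ler_pM2l.
have KY : 2^-1 * (K * s) <= K * Y by rewrite mulrCA ler_pM2l.
have Ks : s <= K * s by rewrite ler_peMl//; lra.
split; rewrite -mulrA; lra.
Qed.

(** Both errors are measured against the combination of [b], also for [t], which is not assumed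
    basic; they are at most [1 / (4 * K)] and [1 / (2 * K)] times its norm and are absorbed. *)
Lemma perturbed_equivalence (b t y u : nat -> E) (K : R) : 1 <= K ->
  basic_sequence b -> (forall j, `|b j| = 1) ->
  (forall a n, `|\sum_(j < n) a j *: t j| <= K * `|\sum_(j < n) a j *: b j|) ->
  (forall a n, `|\sum_(j < n) a j *: b j| <= K * `|\sum_(j < n) a j *: t j|) ->
  (forall j, `|y j - b j| <= 2^-1 ^+ j * (32 * K)^-1) ->
  (forall j, `|u j - t j| <= 2^-1 ^+ j * (16 * K)^-1) ->
  forall (a : nat -> R) n,
    `|\sum_(j < n) a j *: y j| <= 3 * K * `|\sum_(j < n) a j *: u j| /\
    `|\sum_(j < n) a j *: u j| <= 3 * K * `|\sum_(j < n) a j *: y j|.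
Proof.
move=> K1; have K0 : 0 < K by lra.
have c1 : 8 * 32^-1 = 4^-1 :> R by lra.
have c2 : 8 * 16^-1 = 2^-1 :> R by lra.
move=> bb b1 tb bt yb ut a n.
have pert (v w : nat -> E) (eta : R) : 0 <= eta ->
    (forall j, `|v j - w j| <= 2^-1 ^+ j * eta) ->
    `|\sum_(j < n) a j *: v j - \sum_(j < n) a j *: w j| <=
      8 * eta * `|\sum_(j < n) a j *: b j|.
  move=> eta0 vw; rewrite -sumrB.
  under eq_bigr do rewrite -scalerBr.
  by apply: (basic_perturbation bb (d := fun j => v j - w j)) => // j; rewrite b1 mulr1.
have h1 := pert y b _ _ yb; have h2 := pert u t _ _ ut.
have h3 := tb a n; have h4 := bt a n.
have K32 : 0 <= (32 * K)^-1 by rewrite invr_ge0 mulr_ge0// ltW.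
have K16 : 0 <= (16 * K)^-1 by rewrite invr_ge0 mulr_ge0// ltW.
move: h1 h2 => /(_ K32) h1 /(_ K16) h2.
rewrite !invfM mulrA c1 -mulrA in h1; rewrite !invfM mulrA c2 -mulrA in h2.
set s := `|\sum_(j < n) a j *: b j| in h1 h2 h3 h4.
have s0 : 0 <= s by exact: normr_ge0.
apply: (@perturbation_estimate K (K^-1 * s) s `|\sum_(j < n) a j *: t j|) => //.
- by rewrite mulr_ge0// invr_ge0 ltW.
- by rewrite ler_piMl// invf_le1.
- by rewrite mulrA divff ?mul1r// gt_eqF.
- by rewrite mulrC ler_pdivrMr// mulrC.
- rewrite (le_trans _ (lerD h1 (lexx s)))//.
  by rewrite -[X in `|X| <= _](subrK (\sum_(j < n) a j *: b j)) ler_normD.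
- rewrite (le_trans _ (lerD h1 (lexx _)))// distrC.
  by rewrite /s -[X in `|X| <= _](subrK (\sum_(j < n) a j *: y j)) ler_normD.
- rewrite (le_trans _ (lerD h2 (lexx _)))//.
  by rewrite -[X in `|X| <= _](subrK (\sum_(j < n) a j *: t j)) ler_normD.
- rewrite (le_trans _ (lerD h2 (lexx _)))// distrC.
  by rewrite -[X in `|X| <= _](subrK (\sum_(j < n) a j *: u j)) ler_normD.
Qed.

(* The second player's play against a winning strategy [nu]: [lo j, hi j] is the
   range of [y j], and [F j] lists the basis vectors strictly between the ranges of
   [y (j-1)] and [y j], so that every [u] can be spanned by the [F j]. *)
Lemma grid_play e z (nu : seq move -> nat) D phi (lo hi N : nat -> nat)
    (y u : nat -> V) (kappa : nat) :
  (forall N, 0 \in D N) -> (forall N, 1 \in D N) ->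
  (forall N, {subset D N <= D N.+1}) -> (forall n, (phi n < phi n.+1)%N) ->
  (nu [::] <= phi 0)%N ->
  (forall n p, (size p <= 4 * n.+1)%N -> (forall m, m \in p -> grid_move D z phi n m) ->
    (nu p <= phi n.+1)%N) ->
  (kappa < lo 0)%N -> (forall j, (lo j <= hi j)%N) -> (forall j, (hi j <= N j)%N) ->
  (forall j, (N j < lo j.+1)%N) ->
  (forall j, exists q : nat -> rat, [/\ forall k, (k <= hi j)%N -> q k \in D (phi (hi j)),
    forall k, (k < lo j)%N -> q k = 0 & y j = \sum_(k < (hi j).+1) q k *: z (phi k)]) ->
  (forall j, exists q : nat -> rat, [/\ forall k, (k <= N j)%N -> q k \in D (phi (N j)),
    forall k i, (lo i <= k <= hi i)%N -> q k = 0 &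
    u j = \sum_(k < (N j).+1) q k *: z (phi k)]) ->
  (forall j, y j != 0) ->
  (forall (a : nat -> R) n,
    let y' := \sum_(j < n) a j *: eval_code e (y j) in
    let u' := \sum_(j < n) a j *: eval_code e (u j) in
    `|y'| <= kappa%:R * `|u'| /\ `|u'| <= kappa%:R * `|y'|) ->
  exists2 f : nat -> move, (forall i, legal z (nu (mkseq f i)) (f i)) &
    forall k, embedding_position e (mkseq f k).
Proof.
move=> D0 D1 DS phiS nu0 nuP lo0 lohi hiN Nlo yP uP y0 yu.
have phi_le := increasing_leq phiS.
have hilo j : (hi j < lo j.+1)%N by exact: leq_ltn_trans (hiN j) (Nlo j).
have loS j : (lo j < lo j.+1)%N by exact: leq_ltn_trans (lohi j) (hilo j).
have jlo j : (j < lo j)%N.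
  elim: j => [|j IHj]; first exact: leq_ltn_trans (leq0n kappa) lo0.
  exact: leq_ltn_trans IHj (loS j).
have lopred j : (lo j).-1.+1 = lo j by rewrite prednK// (leq_ltn_trans _ (jlo j)).
have gbasis k n : (k <= n)%N -> grid_vector D z phi n (z (phi k)).
  move=> kn; apply: (grid_vector_le D0 DS phiS kn).
  exists (fun i => (i == k)%:R); split; last exact: (sum_delta (z \o phi)).
  by move=> i ik; case: eqP => _; [exact: D1|exact: D0].
have g0 n : grid_vector D z phi n 0.
  by exists (fun=> 0); split=> // ; rewrite big1// => i _; rewrite scale0r.
(* The list [F j] starts just after the range of [y j.-1], or at 0 if [j] is 0. *)
pose s j := if j is j'.+1 then (hi j').+1 else 0%N.
pose F j := [seq z (phi n) | n <- iota (s j) (lo j - s j)].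
have FP j v : v \in F j -> exists2 n, (s j <= n < lo j)%N & v = z (phi n).
  move=> /mapP[n]; rewrite mem_iota => /andP[sn nlo] ->; exists n => //.
  rewrite sn/=; have [sl|ls] := leqP (s j) (lo j); first by rewrite subnKC in nlo.
  by move: nlo; rewrite (eqP (ltnW ls : (lo j - s j == 0)%N)) addn0 ltnNge sn.
pose f i : move := if odd i then ([:: y i./2], 0, 0%N)
  else (F i./2, (if i./2 is j.+1 then u j else 0), kappa).
have f_odd j : f j.*2.+1 = ([:: y j], 0, 0%N).
  by rewrite /f /= odd_double/= uphalf_double.
have f_even j : f j.*2 = (F j, (if j is j'.+1 then u j' else 0), kappa).
  by rewrite /f odd_double doubleK.
(* The list of move [i] uses indices from [start i] to [level i]. As [start i.+1 = (level i).+1],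
   the answer of [nu] to moves up to [i] is at most [phi (start i.+1)]. *)
pose level i := if odd i then hi i./2 else (lo i./2).-1.
pose start i := if odd i then lo i./2 else s i./2.
have startS i : start i.+1 = (level i).+1.
  rewrite /start /level /= uphalf_half; by case: (odd i).
have level_le i j : (i <= j)%N -> (level i <= level j)%N.
  elim: j => [|j IHj]; first by rewrite leqn0 => /eqP->.
  rewrite leq_eqVlt => /orP[/eqP->//|/IHj ij]; apply: leq_trans ij _.
  rewrite /level /= uphalf_half; case: (odd j) => /=.
    by rewrite ?add1n -ltnS lopred.
  by rewrite ?add0n (leq_trans (leq_pred _)).
have half_level i : (i./2 <= level i)%N.
  rewrite /level; case: (odd i); first by rewrite ltnW// (leq_trans (jlo _)).
  by rewrite -ltnS lopred.
have grid_f i : grid_move D z phi (level i) (f i).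
  rewrite -[i]odd_double_half; set j := i./2; case: (odd i) => /=.
    rewrite ?add1n f_odd /level /= odd_double/= uphalf_double; split=> //=.
    move=> v; rewrite inE => /eqP->.
    by have [q [qD _ yE]] := yP j; exists q.
  rewrite ?add0n f_even /level odd_double doubleK; split=> /=.
  - by rewrite size_map size_iota lopred leq_subr.
  - by move=> v /FP[n /andP[_ nlo] ->]; apply: gbasis; rewrite -ltnS lopred.
  - case: j => // j; have [q [qD _ uE]] := uP j.
    apply: (grid_vector_le D0 DS phiS (n := N j)); first by rewrite -ltnS lopred.
    by exists q.
  - rewrite -ltnS lopred; apply: leq_trans lo0 _.
    by elim: (j) => // j' IH; exact: leq_trans IH (ltnW (loS j')).
exists f.
  move=> i; have sf v : v \in (f i).1.1 -> span_from z (phi (start i)) v.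
    rewrite -[i]odd_double_half; set j := i./2; case: (odd i) => /=.
      rewrite ?add1n f_odd /start /= odd_double/= uphalf_double inE => /eqP->.
      have [q [_ q0 ->]] := yP j; apply: span_from_sum => k.
      have [klo|lok] := ltnP k (lo j); first by rewrite q0// scale0r; exact: span_from0.
      by apply: span_fromZ; apply: span_from_basis; exact: phi_le.
    rewrite ?add0n f_even /start odd_double doubleK => /FP[n /andP[sn _] ->].
    by apply: span_from_basis; exact: phi_le.
  move=> v /sf; apply: span_from_le; case: i {sf} => [|i]; first exact: nu0.
  rewrite startS; apply: nuP.
    by rewrite size_mkseq; have := half_level i; lia.
  move=> m /mapP[k]; rewrite mem_iota add0n ltnS /= => ki ->.
  exact: grid_move_le (level_le _ _ ki) (grid_f k).
move=> k; split.
- move=> j; rewrite size_mkseq /source => jk.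
  by rewrite nth_mkseq// f_odd/= big_seq1.
- move=> j z'; rewrite size_mkseq /target => jk Fz.
  rewrite nth_mkseq// -doubleS f_even/=.
  have [q [_ q0 ->]] := uP j; apply: span_from_sum => n.
  have [->|qn] := eqVneq (q n) 0; first by rewrite scale0r; exact: span_from0.
  apply: span_fromZ.
  have nlo : (n < lo j.+1)%N by apply: leq_ltn_trans (Nlo j); rewrite -ltnS.
  (* Take the first [i] with [n < lo i]. As [q] vanishes on the range of [y i.-1], the index [n]
     lies after that range, hence in the gap listed by [F i]. *)
  have [i [il ni]] : exists i, (i <= j.+1)%N /\ (s i <= n < lo i)%N.
    have ex : exists i, (n < lo i)%N by exists j.+1.
    exists (ex_minn ex); case: ex_minnP => i ni imin; split; first exact: imin.
    rewrite ni andbT; case: i ni imin => //= i ni imin; rewrite ltnNge.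
    apply: contra_neqN qn => nhi; apply: (q0 n i); rewrite nhi andbT leqNgt.
    by apply/negP => /imin; rewrite ltnn.
  apply: (Fz i) => //; rewrite nth_mkseq; last first.
    by rewrite (leq_ltn_trans _ jk)// -doubleS leq_double.
  rewrite f_even/=; apply/mapP; exists (n : nat) => //.
  by rewrite mem_iota; case/andP: ni => sn nl; rewrite sn subnKC// ltnW// (leq_ltn_trans sn).
- move=> l a; rewrite size_mkseq => lk.
  have -> : nth pass (mkseq f k) 0 = f 0.*2 by rewrite nth_mkseq// (leq_ltn_trans _ lk).
  rewrite f_even /=.
  have E1 (j : 'I_l) : source (mkseq f k) j = y j.
    have jk : (j.*2.+1 < k)%N by rewrite (leq_ltn_trans _ lk)// ltn_double.
    by rewrite /source nth_mkseq// f_odd/= big_seq1.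
  have E2 (j : 'I_l) : target (mkseq f k) j = u j.
    have jk : (j.*2.+2 < k)%N by rewrite (leq_ltn_trans _ lk)// -doubleS leq_double.
    by rewrite /target nth_mkseq// -doubleS f_even.
  have S1 : \sum_(j < l) a j *: eval_code e (source (mkseq f k) j) =
      \sum_(j < l) a j *: eval_code e (y j) by apply: eq_bigr => j _; rewrite E1.
  have S2 : \sum_(j < l) a j *: eval_code e (target (mkseq f k) j) =
      \sum_(j < l) a j *: eval_code e (u j) by apply: eq_bigr => j _; rewrite E2.
  rewrite S1 S2; exact: yu.
Qed.

End Tightness.

Section SpoilerTight.
Context {R : realType} {E : completeNormedModType R}.
Local Notation V := {poly rat}.
Implicit Types (a b : nat -> R) (e f : nat -> E) (z : nat -> V) (D : nat -> seq rat).

Lemma lincombE e a M : supp a `<=` `I_M -> lincomb e a = \sum_(i < M) a i *: e i.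
Proof.
move=> aM; have -> : lincomb e a = \sum_(i \in `I_M) a i *: e i.
  apply: fsbig_widen => // i [_ /= /negP]; rewrite negbK => /eqP ->.
  by rewrite scale0r.
by rewrite -fsbig_ord.
Qed.

Lemma finite_nat_bound (A : set nat) : finite_set A -> exists M, A `<=` `I_M.
Proof.
move=> /(finite_set_bound id)[B BP]; exists B.+1 => n /BP.
by rewrite /= ltnS.
Qed.

Lemma infinite_set_unbounded (A : set nat) n : infinite_set A ->
  exists2 i, A i & (n <= i)%N.
Proof.
move=> Ainf; apply: contrapT => h; apply: Ainf.
apply: (@sub_finite_set _ _ `I_n) => [i Ai /=|]; last exact: finite_II.
by rewrite ltnNge; apply/negP => ni; apply: h; exists i.
Qed.

Lemma isomorphic_bounds (X Z : set E) : submod_closed (mem X) ->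
  submod_closed (mem Z) -> isomorphic X Z -> exists (T : E -> E) (K : R),
  [/\ 1 <= K, linear_on X T, forall x, X x -> Z (T x) &
      forall x, X x -> `|T x| <= K * `|x| /\ `|x| <= K * `|T x| ].
Proof.
move=> Xs Zs [T [S [Tl TX SZ Tc Sc]]].
have Sl : linear_on Z S.
  move=> r u v /set_mem uZ /set_mem vZ.
  have [Su Tu] := SZ _ uZ; have [Sv Tv] := SZ _ vZ.
  have h : X (r *: S u + S v) by have [_ l] := Xs; apply/set_mem/l; exact/mem_set.
  rewrite -[in LHS]Tu -[in LHS]Tv -Tl; [|exact/mem_set|exact/mem_set].
  by have [_ ->] := TX _ h.
have [K1 K10 K1P] := continuous_linear_on_bounded Xs Tl Tc.
have [K2 K20 K2P] := continuous_linear_on_bounded Zs Sl Sc.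
exists T, (1 + K1 + K2); split=> //; first by lra.
  by move=> x /TX[].
move=> x Xx; have [ZT ST] := TX _ Xx.
split; first by rewrite (le_trans (K1P _ Xx))// ler_wpM2r//; lra.
by rewrite -[in leLHS]ST (le_trans (K2P _ ZT))// ler_wpM2r//; lra.
Qed.

(** Rounding keeps zero coefficients zero, so the codes obtained still avoid the ranges that the
    real combination avoids. *)
Lemma grid_rounding e z D (phi : nat -> nat) n b :
  basic_sequence (fun k => eval_code e (z k)) ->
  (forall n, (phi n < phi n.+1)%N) ->
  (forall N k (c : R), (k <= N)%N -> `|c| <= N.+1%:R -> exists q,
     [/\ q \in D N, c = 0 -> q = 0 &
         `|c - ratr q * `|eval_code e (z k)| | <= 4^-1 ^+ N]) ->
  (forall k, (k <= n)%N -> `|b k| <= n.+1%:R) ->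
  exists q : nat -> rat, [/\ forall k, (k <= n)%N -> q k \in D (phi n),
    forall k, b k = 0 -> q k = 0 &
    `|eval_code e (\sum_(k < n.+1) q k *: z (phi k)) -
      \sum_(k < n.+1) b k *: normalised_code e (z \o phi) k| <= 2^-1 ^+ n].
Proof.
move=> [z0 _] phiS DP bn.
have phin k : (k <= phi k)%N by elim: k => // k IHk; exact: leq_ltn_trans IHk (phiS k).
have phi_le := increasing_leq phiS.
have /choice[q qP] k : exists q, ((k <= n)%N -> q \in D (phi n) /\
    `|b k - ratr q * `|eval_code e (z (phi k))| | <= 4^-1 ^+ phi n) /\ (b k = 0 -> q = 0).
  have [kn|//] := leqP k n; last by exists 0.
  have [|q [h1 h2 h3]] := DP (phi n) (phi k) (b k) (phi_le _ _ kn).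
    by apply: (le_trans (bn _ kn)); rewrite ler_nat ltnS.
  by exists q.
exists q; split.
- by move=> k kn; have [/(_ kn)[]] := qP k.
- by move=> k; have [] := qP k.
rewrite (eval_code_sum e n.+1 q (fun k => z (phi k))) -sumrB (le_trans (ler_norm_sum _ _ _))//.
apply: (@le_trans _ _ (\sum_(k < n.+1) 4^-1 ^+ n)).
  apply: ler_sum => k _; have kn : (k <= n)%N by rewrite -ltnS.
  have [/(_ kn)[_ h] _] := qP k.
  have fk : 0 < `|eval_code e (z (phi k))| by rewrite normr_gt0.
  rewrite /normalised_code/= scalerA -scalerBl normrZ.
  rewrite -[X in _ * X]gtr0_norm// -normrM mulrBl.
  rewrite divfK ?gt_eqF// distrC (le_trans h)//.
  by rewrite ler_wiXn2l//; lra.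
(* There are [n.+1] errors of size at most [4^-1 ^+ n], and [n.+1 <= 2 ^ n]. *)
rewrite sumr_const card_ord -[_ *+ n.+1]mulr_natl.
have -> : (4^-1 : R) ^+ n = 2^-1 ^+ n * 2^-1 ^+ n.
  by rewrite -exprMn; congr (_ ^+ _); lra.
rewrite mulrA ler_piMl ?exprn_ge0// exprVn ler_pdivrMr ?exprn_gt0// mul1r.
by rewrite -natrX ler_nat ltn_expl.
Qed.

End SpoilerTight.

Section MainSteps.
Context {R : realType} {E : completeNormedModType R}.
Local Notation V := {poly rat}.
Implicit Types (a b : nat -> R) (e f : nat -> E) (z : nat -> V).

Lemma block_bounds e (F : {pred R}) a : block e F a -> exists lo hi,
  [/\ (lo <= hi)%N, a lo != 0, a hi != 0 & forall n, a n != 0 -> (lo <= n <= hi)%N].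
Proof.
move=> [[afin _] a1].
have [M aM] := finite_nat_bound afin.
have ex : exists n, a n != 0.
  apply: contrapT => h; have : lincomb e a = 0.
    rewrite (lincombE e aM) big1// => i _.
    have [->|ai] := eqVneq (a i) 0; first by rewrite scale0r.
    by case: h; exists i.
  by move=> l0; move: a1; rewrite l0 normr0 => /eqP; rewrite eq_sym oner_eq0.
have ub n : a n != 0 -> (n <= M)%N by move=> an; exact: ltnW (aM _ an).
exists (ex_minn ex), (ex_maxn ex ub).
case: ex_minnP => lo alo lo_min; case: ex_maxnP => hi ahi hi_max.
split=> //; first exact: lo_min.
by move=> n an; rewrite lo_min ?hi_max.
Qed.

Lemma block_range_itv a lo hi n : a lo != 0 -> a hi != 0 -> (lo <= n <= hi)%N ->
  block_range a n.
Proof. by move=> alo ahi lnh I [Ii aI]; apply: (Ii lo n hi) => //; exact: aI. Qed.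

(** An embedding [T] of the block subspace would give, for sparse indices in [A], grid vectors near
    the blocks and near their images. Played against [nu], they never leave the embedding
    positions. *)
Lemma spoiler_tight e z : basic_sequence e -> successive z ->
  spoiler_wins (embedding_position e) z [::] ->
  exists phi : nat -> nat, (forall n, (phi n < phi n.+1)%N) /\
    tight_by_range (normalised_code e (z \o phi)).
Proof.
move=> be sz [nu nuP]; have bz := successive_basic be sz.
have [|D [D0 D1 DS DP]] := @coefficient_grid R (fun k => `|eval_code e (z k)|).
  by move=> k; rewrite normr_gt0; case: bz => + _; apply.
have [phi [phiS nu0 nu_le]] := strategy_bound z nu DS.
exists phi; split=> // F _ y [yb ys] A Ainf.
set x := normalised_code _ _ in yb ys *.
have [bx x1] : basic_sequence x /\ normalised x.
  by apply: normalised_code_basic => //; exact: successive_subsequence.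
have /choice[lo /choice[hi lohi]] i := block_bounds (yb i).
have lo_hi i : (lo i <= hi i)%N by have [] := lohi i.
have y0 i n : ~~ (lo i <= n <= hi i)%N -> y i n = 0.
  by have [_ _ _ h] := lohi i => nlh; apply/eqP; apply: contraNT nlh; exact: h.
have yr i n : (lo i <= n <= hi i)%N -> block_range (y i) n.
  by have [_ h1 h2 _] := lohi i; exact: block_range_itv.
have hi_lo i : (hi i < lo i.+1)%N.
  by have [_ _ h1 _] := lohi i; have [_ h2 _ _] := lohi i.+1; exact: (ys i (hi i) (lo i.+1) h1 h2).
have i_lo i : (i <= lo i)%N.
  by elim: i => // i IHi; exact: leq_ltn_trans (leq_trans IHi (lo_hi i)) (hi_lo i).
pose b i := \sum_(n < (hi i).+1) y i n *: x n.
have bE i : lincomb x (y i) = b i.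
  by apply: lincombE => n /=; have [_ _ _ h] := lohi i => /h/andP[_]; rewrite ltnS.
have b1 i : `|b i| = 1 by rewrite -bE; case: (yb i).
have y4 i n : (n <= hi i)%N -> `|y i n| <= 4.
  by move=> nh; have := basic_coef bx (y i) (nh : (n < (hi i).+1)%N); rewrite x1 -/(b i) b1; lra.
pose X := closed_span (range (fun n => lincomb x (y n))).
pose W := closed_span (x @` ~` \bigcup_(i in A) block_range (y i)).
rewrite -/X -/W.
have Xb i : X (b i) by rewrite -bE; apply: sub_closed_span; exists i.
move=> [Z [[Zs _] ZW]].
move=> /(isomorphic_bounds (closed_span_submod _) Zs)[T [K [K1 Tl TZ TK]]].
have WT i : W (T (b i)) by apply/ZW/TZ/Xb.
(* This is the error allowed for a block; an image may use it twice, once for truncation and once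
   for rounding, giving [(16 * K)^-1]. *)
pose del : R := (32 * K)^-1.
have K0 : 0 < K by lra.
have del0 : 0 < del by rewrite invr_gt0 mulr_gt0.
have del1 : del <= 32^-1 by rewrite lef_pV2 ?posrE ?mulr_gt0//; lra.
(* Approximate the image of block [i] to precision [j] by a finite combination avoiding the ranges
   indexed by [A]. The two indices are independent because [i] is chosen as a function of [j] only
   later. *)
have /choice[Nb NbP] (ij : nat * nat) : exists Nb : nat * (nat -> R),
    [/\ (hi ij.1 <= Nb.1)%N, (ij.2 <= Nb.1)%N,
     forall n i, A i -> (lo i <= n <= hi i)%N -> Nb.2 n = 0,
     forall n, (n <= Nb.1)%N -> `|Nb.2 n| <= Nb.1.+1%:R &
     `|\sum_(n < Nb.1.+1) Nb.2 n *: x n - T (b ij.1)| <= 2^-1 ^+ ij.2 * del].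
  case: ij => i j /=.
  have /closureP/(_ (2^-1 ^+ j * del)) := WT i.
  rewrite mulr_gt0 ?exprn_gt0// => /(_ isT)[w /lin_span_imageP[n [c [cB ->]]]] wT.
  pose c' k := if (k < n)%N then c k else 0.
  have c'E m : (n <= m)%N -> \sum_(k < m) c' k *: x k = \sum_(k < n) c k *: x k.
    by move=> nm; rewrite (sum_widen _ _ nm).
  (* The last entry makes [4 * (K + 1)], a bound for the coefficients, at most [M.+1], as rounding
     in the grid requires. *)
  pose M := maxn (maxn (hi i) j) (maxn n (Num.truncn (4 * (K + 1)))).
  have [M1 M2 M3 M4] : [/\ hi i <= M, j <= M, n <= M & Num.truncn (4 * (K + 1)) <= M]%N.
    by rewrite /M !leq_max !leqnn ?orbT.
  exists (M, c'); split=> //=.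
  - move=> k i' Ai' /yr ki'; rewrite /c'; case: ifP => // _; apply: cB => nB.
    by apply: nB; exists i'.
  - move=> k kM; have := basic_coef bx c' (kM : (k < M.+1)%N).
    rewrite x1 mulr1 c'E ?(leq_trans M3)// => h; apply: (le_trans h).
    apply: (@le_trans _ _ (4 * (K + 1))); last first.
      by apply: ltW; apply: (lt_le_trans (truncnS_gt _)); rewrite ler_nat ltnS.
    rewrite ler_pM2l//; have [Tb _] := TK _ (Xb i); rewrite b1 mulr1 in Tb.
    have : `|\sum_(k < n) c k *: x k| <= `|T (b i) - \sum_(k < n) c k *: x k| + `|T (b i)|.
      by rewrite distrC -[X in `|X| <= _](subrK (T (b i))) ler_normD.
    have : 2^-1 ^+ j * del <= 1.
      by rewrite mulr_ile1 ?exprn_ge0// ?exprn_ile1// ?ltW//; lra.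
    by lra.
  - by rewrite c'E ?(leq_trans M3)// distrC ltW.
have [L LP] := half_powers_small del0.
pose kappa := (Num.truncn (3 * K)).+1.
have kappaK : 3 * K <= kappa%:R by apply: ltW; exact: truncnS_gt.
(* Each block starts after the supports of all earlier images. The summands [L + j] serve the
   rounding error, [kappa] the declared constant, and 5 the bound 4 on block coefficients. *)
have [iota iotaP] : exists iota : nat -> nat, forall j, [/\ A (iota j),
    (forall k, (k < j)%N -> (Nb (iota k, k)).1 < lo (iota j))%N &
    (L + j + kappa + 5 < lo (iota j))%N].
  have [|g gP] := @history_choice nat (fun s i => [/\ A i,
    (forall k, (k < size s)%N -> ((Nb (nth 0%N s k, k)).1 < lo i)%N) &
    (L + size s + kappa + 5 < lo i)%N]).
    move=> s; pose B := maxn (L + size s + kappa + 5)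
      (\max_(k < size s) (Nb (nth 0%N s k, nat_of_ord k)).1).
    have [i Ai Bi] := infinite_set_unbounded B.+1 Ainf.
    exists i; split=> // [k ks|].
      apply: leq_trans (i_lo i); apply: leq_ltn_trans Bi; apply: leq_trans (leq_maxr _ _).
      exact: (@leq_bigmax _
        (fun k : 'I_(size s) => (Nb (nth 0%N s k, nat_of_ord k)).1) (Ordinal ks)).
    by apply: leq_trans (i_lo i); apply: leq_ltn_trans Bi; exact: leq_maxl.
  exists g => j; have [h1 h2 h3] := gP j; rewrite size_mkseq in h2 h3.
  by split=> // k kj; have := h2 k kj; rewrite nth_mkseq.
pose lo' j := lo (iota j); pose hi' j := hi (iota j).
pose N' j := (Nb (iota j, j)).1.
have hiN j : (hi' j <= N' j)%N by have [] := NbP (iota j, j).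
have Nlo j : (N' j < lo' j.+1)%N by have [_ h _] := iotaP j.+1; exact: h.
have lo5 j : (L + j + kappa + 5 < lo' j)%N by have [] := iotaP j.
have half_le n m : (n <= m)%N -> (2^-1 : R) ^+ m <= 2^-1 ^+ n.
  by move=> nm; rewrite ler_wiXn2l//; lra.
have half_small j n : (L + j <= n)%N -> (2^-1 : R) ^+ n <= 2^-1 ^+ j * del.
  move=> Ljn; apply: (le_trans (half_le _ _ Ljn)); rewrite addnC exprD.
  by rewrite ler_wpM2l ?exprn_ge0// ltW// LP.
have rounding n c : (forall k, (k <= n)%N -> `|c k| <= n.+1%:R) ->
    exists v, (exists q : nat -> rat, [/\ forall k, (k <= n)%N -> q k \in D (phi n),
      forall k, c k = 0 -> q k = 0 & v = \sum_(k < n.+1) q k *: z (phi k)]) /\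
      `|eval_code e v - \sum_(k < n.+1) c k *: x k| <= 2^-1 ^+ n.
  move=> cn; have [q [qD q0 qc]] := grid_rounding bz phiS DP cn.
  by exists (\sum_(k < n.+1) q k *: z (phi k)); split=> //; exists q.
have lohi' j : (lo' j <= hi' j)%N by exact: lo_hi.
have y5 j k : (k <= hi' j)%N -> `|y (iota j) k| <= (hi' j).+1%:R.
  move=> /y4 h; apply: (le_trans h); rewrite (ler_nat R 4).
  by have := lo5 j; have := lohi' j; lia.
have bN j k : (k <= N' j)%N -> `|(Nb (iota j, j)).2 k| <= (N' j).+1%:R.
  by have [_ _ _ h _] := NbP (iota j, j); exact: h.
have /choice[yt ytP] := fun j => rounding _ _ (y5 j).
have /choice[ut utP] := fun j => rounding _ _ (bN j).
have hi_lo'' j k : (j < k)%N -> (hi' j < lo' k)%N.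
  by move=> jk; have [_ h _] := iotaP k; exact: leq_ltn_trans (hiN j) (h _ jk).
have bb : basic_sequence (fun j => b (iota j)).
  apply: (basic_blocks (c := fun j n => y (iota j) n) (s := fun j => (hi' j).+1)) => //.
  - apply: homo_leq => [//|n m k|j]; first exact: leq_trans.
    by rewrite ltnS ltnW// (leq_trans (hi_lo'' j j.+1 (ltnSn j))).
  - by move=> j; exists (hi' j) => //; have [_ _ h _] := lohi (iota j).
  - by move=> j n nh; apply: y0; rewrite negb_and -!ltnNge nh orbT.
  - move=> j k n jk nj; apply: y0; rewrite negb_and -ltnNge.
    by rewrite (leq_ltn_trans _ (hi_lo'' j k jk)).
have Xs : submod_closed (mem X) := closed_span_submod _.
have ytb j : `|eval_code e (yt j) - b (iota j)| <= 2^-1 ^+ j * del.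
  have [_ h] := ytP j; apply: (le_trans h); apply: half_small.
  by have := lo5 j; have := lohi' j; lia.
have utb j : `|eval_code e (ut j) - T (b (iota j))| <= 2^-1 ^+ j * (16 * K)^-1.
  have [_ h1] := utP j; have [_ _ _ _ h2] := NbP (iota j, j).
  have h3 : (2^-1 : R) ^+ N' j <= 2^-1 ^+ j * del.
    by apply: half_small; have := lo5 j; have := lohi' j; have := hiN j; lia.
  have dE : (16 * K)^-1 = del + del.
    rewrite /del !invfM -mulrDl; congr (_ * _); lra.
  rewrite dE mulrDr; apply: (le_trans _ (lerD (le_trans h1 h3) h2)).
  by rewrite (le_trans _ (ler_normD _ _))// addrA subrK.
have TS a n : T (\sum_(j < n) a j *: b (iota j)) = \sum_(j < n) a j *: T (b (iota j)).
  exact: (linear_on_sum Xs Tl a (fun j (_ : (j < n)%N) => Xb (iota j))).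
have XS a n : X (\sum_(j < n) a j *: b (iota j)).
  exact: (submod_comb Xs a (fun j (_ : (j < n)%N) => Xb (iota j))).
have tb a n : `|\sum_(j < n) a j *: T (b (iota j))| <= K * `|\sum_(j < n) a j *: b (iota j)|.
  by rewrite -TS; case: (TK _ (XS a n)).
have bt a n : `|\sum_(j < n) a j *: b (iota j)| <= K * `|\sum_(j < n) a j *: T (b (iota j))|.
  by rewrite -TS; case: (TK _ (XS a n)).
have equiv := perturbed_equivalence K1 bb (fun j => b1 (iota j)) tb bt ytb utb.
have yt0 j : yt j != 0.
  apply/eqP => yt0; have := ytb j; rewrite yt0 eval_code0 sub0r normrN b1.
  have : 2^-1 ^+ j * del <= 1 * 32^-1.
    apply: ler_pM => //; first exact: ltW.
    by rewrite exprn_ile1//; lra.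
  lra.
have [f fl fg] : exists2 f : nat -> move, (forall i, legal z (nu (mkseq f i)) (f i)) &
    forall k, embedding_position e (mkseq f k).
  apply: (@grid_play R E e z nu D phi lo' hi' N' yt ut kappa) => //.
  - by have := lo5 0%N; lia.
  - move=> j; have [[q [qD q0 qE]] _] := ytP j; exists q; split=> // k klo.
    by apply: q0; apply: y0; rewrite negb_and -ltnNge klo.
  - move=> j; have [[q [qD q0 qE]] _] := utP j; exists q; split=> // k i kr.
    apply: q0; have [_ _ h _ _] := NbP (iota j, j).
    by apply: (h k (iota i)) => //; have [] := iotaP i.
  - move=> a n /=; have [h1 h2] := equiv a n.
    by split; [apply: (le_trans h1)|apply: (le_trans h2)]; rewrite ler_wpM2r.
by have [k] := nuP f fl; apply; exact: fg.
Qed.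

End MainSteps.

(** * The dichotomy for infinite-dimensional spaces *)

Theorem theorem1p4 (R : realType) (E : completeNormedModType R)
    (hE : infinite_dimensional [set: E]) :
  exists (X : set E) (e : nat -> E),
    [/\ inf_closed_subspace X,
        schauder_basis X e,
        normalised e &
        tight_by_range e \/ subsequentially_minimal e].
Proof.
have [e be] := basic_sequence_exists hE.
suff [x sx xP] : exists2 x, successive x &
    tight_by_range (normalised_code e x) \/ subsequentially_minimal (normalised_code e x).
  have [bx x1] := normalised_code_basic be sx.
  exists (closed_span (range (normalised_code e x))), (normalised_code e x).
  by split=> //; [exact: basic_closed_span|exact: basic_schauder].
have [z sz [/(spoiler_tight be sz)[phi [phiS tight]]|[G [G0 GP]]]] :=
  game_dichotomy (embedding_position e).
  exists (z \o phi); last by left.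
  exact: successive_subsequence.
have [x [sx xz xP]] := subsequence_embedding sz G0 GP.
exists x => //; right; apply: embedding_subsequentially_minimal xP => // n.
by have [x0 _] := successive_basic be sx; rewrite invr_eq0 normr_eq0.
Qed.
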